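(* The problem $$\hat u_{zz}(\rho,z)-\lambda_{\rho,k}\hat u(\rho,z)=-\hat f(\rho,z)\ \ (z\in(0,d)),\qquad\hat u(\rho,d)=\hat g(\rho),\qquad\partial_z\hat u(\rho,d)=0,$$ considered for $\rho\in A_1=\{\rho\in\mathbb{R}^2:\lambda_{\rho,k}>0\}$, is ill-posed in the sense of Hadamard in the $L^2$-norm; that is, its solution does not depend continuously on the data: there exist sequences $g_n\in L^2(\mathbb{R}^2)$ and $f_n\in L^2(\Omega)$ whose Fourier transforms (in $\xi$) are supported in $\rho\in A_1$, with $$\|g_n\|_{L^2(\mathbb{R}^2)}\to0\quad\text{and}\quad\|f_n\|_{L^2(\Omega)}\to0\qquad(n\to\infty),$$ while the corresponding solutions $\hat u_n$ (with $\hat u_n(\rho,\cdot)=0$ for $\rho\notin A_1$), with inverse Fourier transforms $u_n$ in $\xi$, satisfy $\|u_n(\cdot,0)\|_{L^2(\mathbb{R}^2)}\to\infty$ as $n\to\infty$.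
   Context: $d>0$, $\Omega=\mathbb{R}^2\times(0,d)$, points of $\Omega$ are written $(\xi,z)$ with $\xi\in\mathbb{R}^2$; $k>0$ with $kd<\frac\pi2$ (standing assumption). Functions are complex valued. The hat denotes the Fourier transform in $\xi$: $\hat v(\rho)=\int_{\mathbb{R}^2}v(\xi)e^{-2\pi i\langle\rho,\xi\rangle}d\xi$ (extended to $L^2$). $\lambda_{\rho,k}:=|\rho|^2-k^2$. *)

(* Defs.v *)
From mathcomp Require Import all_boot all_order all_algebra.
From mathcomp Require Import complex.
From mathcomp Require Import all_classical all_reals all_analysis.

Set Implicit Arguments.
Unset Strict Implicit.
Unset Printing Implicit Defensive.
Import Order.TTheory GRing.Theory Num.Theory.
Import numFieldNormedType.Exports.

Local Open Scope classical_set_scope.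
Local Open Scope ring_scope.
Local Open Scope complex_scope.

Section ComplexL2.
Context {d : measure_display} {T : measurableType d} {R : realType}.
Variable mu : {measure set T -> \bar R}.
Implicit Types (D : set T) (f : T -> R[i]).

Definition cmeasurable D f : Prop :=
  measurable_fun D (fun x => complex.Re (f x)) /\
  measurable_fun D (fun x => complex.Im (f x)).

Definition cintegrable D f : Prop :=
  mu.-integrable D (fun x => (complex.Re (f x))%:E) /\
  mu.-integrable D (fun x => (complex.Im (f x))%:E).

Definition cintegral D f : R[i] :=
  (\int[mu]_(x in D) complex.Re (f x)) +i* (\int[mu]_(x in D) complex.Im (f x)).

Definition L2norm D f : \bar R :=
  'N[mu]_2%:E[(fun x => (ComplexField.Normc.normc (f x))%:E) \_ D]%E.

Definition inL2 D f : Prop := cmeasurable D f /\ (L2norm D f < +oo)%E.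

End ComplexL2.

Section Fourier.
Context {R : realType}.
Implicit Types (rho xi : R * R) (z : R).

Definition mu1 : {measure set (measurableTypeR R) -> \bar R} :=
  @lebesgue_measure R.

Definition mu2 :
    {measure set (measurableTypeR R * measurableTypeR R) -> \bar R} :=
  (@lebesgue_measure R \x @lebesgue_measure R)%E.

Definition mu3 :
    {measure set (measurableTypeR R * measurableTypeR R * measurableTypeR R) ->
      \bar R} :=
  ((@lebesgue_measure R \x @lebesgue_measure R) \x @lebesgue_measure R)%E.

(* the layer R^2 x (0, d); a point (xi, z) is a pair with xi : R * R *)
Definition layer (d : R) : set (R * R * R) := [set x | 0 < x.2 < d].

Definition dotR2 rho xi : R := rho.1 * xi.1 + rho.2 * xi.2.

Definition expi (t : R) : R[i] := cos t +i* sin t.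

Definition fourierL1 (v : R * R -> R[i]) rho : R[i] :=
  cintegral mu2 setT (fun xi => v xi * expi (- (2 * pi * dotR2 rho xi))).

(* vh represents the Fourier transform of v in L^2(R^2): the relation is the
   L^2-closure of the integral formula on L^1 and L^2, i.e. the graph of its
   continuous extension.  Both functions are determined up to null sets. *)
Definition is_fourier (v vh : R * R -> R[i]) : Prop :=
  [/\ inL2 mu2 setT v,
      inL2 mu2 setT vh &
      exists w : nat -> R * R -> R[i],
        [/\ forall j, cintegrable mu2 setT (w j) /\ inL2 mu2 setT (w j),
            L2norm mu2 setT (fun xi => w j xi - v xi) @[j --> \oo] --> 0%E &
            L2norm mu2 setT (fun rho => fourierL1 (w j) rho - vh rho)
              @[j --> \oo] --> 0%E]].

(* Fourier transform in the horizontal variable of a function in L^2(layer) *)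
Definition is_layer_fourier (d : R) (v vh : R * R * R -> R[i]) : Prop :=
  [/\ inL2 mu3 (layer d) v,
      inL2 mu3 (layer d) vh &
      {ae mu1, forall z, 0 < z < d ->
        is_fourier (fun xi => v (xi, z)) (fun rho => vh (rho, z))}].

Definition lambda (k : R) rho : R := dotR2 rho rho - k ^+ 2.

Definition A1 (k : R) : set (R * R) := [set rho | 0 < lambda k rho].

(* v is absolutely continuous on [0, d] with (a.e.) derivative w; if w is itself
   absolutely continuous, w is the classical derivative on [0, d], one-sided at
   the endpoints *)
Definition ac_derivative (d : R) (v w : R -> R[i]) : Prop :=
  cintegrable mu1 `[0, d] w /\
  forall z, 0 <= z <= d -> v z = v 0 + cintegral mu1 `[0, z] w.

(* v'' - l v = - F on (0, d), v(d) = G, v'(d) = 0; since F is only square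
   integrable, v and v' are absolutely continuous and the equation holds a.e. *)
Definition cauchy_solution (d l : R) (F : R -> R[i]) (G : R[i])
    (v : R -> R[i]) : Prop :=
  exists v1 v2 : R -> R[i],
    [/\ ac_derivative d v v1,
        ac_derivative d v1 v2,
        {ae mu1, forall z, 0 < z < d -> v2 z - l%:C * v z = - F z},
        v d = G &
        v1 d = 0].

(* uh is the solution, extended by 0 outside A1, for the transformed data
   (gh, fh), and u is its inverse Fourier transform in the horizontal variable;
   slices are taken at every height because u(., 0) is the trace at z = 0 *)
Definition corresponding_solution (d k : R)
    (gh : R * R -> R[i]) (fh uh u : R * R * R -> R[i]) : Prop :=
  [/\ {ae mu2, forall rho, A1 k rho ->
        cauchy_solution d (lambda k rho) (fun z => fh (rho, z)) (gh rho)
          (fun z => uh (rho, z))},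
      {ae mu2, forall rho, ~ A1 k rho ->
        forall z, 0 <= z <= d -> uh (rho, z) = 0} &
      forall z, 0 <= z <= d ->
        is_fourier (fun xi => u (xi, z)) (fun rho => uh (rho, z))].

End Fourier.

(* Main.v *)
Require Import Defs.
From HB Require Import structures.
From mathcomp Require Import all_boot all_order all_algebra complex.
From mathcomp Require Import ring lra.
From mathcomp Require Import all_classical all_reals all_analysis.
From mathcomp Require Import measurable_realfun.
Import Order.TTheory GRing.Theory Num.Theory.
Import numFieldNormedType.Exports.

(** The problem decouples over the frequencies [rho]. For [f = 0] the solution
  at
    a frequency with [lambda > 0] is [gh rho * cosh (sqrt lambda * (d - z))], so
    passing from [z = d] to [z = 0] multiplies the data by
    [cosh (sqrt lambda * d)], which is unbounded on [A1]. Take for [gh n] a tent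
    bump of height [1 / n.+1] moved out to where [n.+1 <= sqrt lambda]: the data
    tend to 0 in [L^2], while the transformed trace at [z = 0] is at least a
    constant multiple of [n.+1] times the bump ([profile0_ge]). The transformed
    solution at height [z] is [profile d k n z].

    These functions of [rho] must be transforms of functions of [xi] in the
      sense
    of the closure [is_fourier]; [fourier_inversion] proves it for every
    nonnegative, bounded, continuous and integrable [h]. Multiply the inverse
    transform of [h] by the window [exp (- 2 pi e (|x1| + |x2|))]. The transform
    of the window is a product of Poisson kernels, so the transform of the
    windowed function is the Poisson mean of [h] ([fourier_windowed]). As [e]
    tends to 0, the Poisson means converge to [h] pointwise, and by Jensen's
    inequality they do not exceed the norm of [h], so they converge in [L^2]
    ([smooth_L2_cvg]). The windowed functions converge in [L^2] because the
    missing mass is controlled by the same computation, which also yields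
    [plancherel]; the latter gives the norm of the data.

    The blow-up is claimed for every family of corresponding solutions. At
      almost
    every frequency the Cauchy problem has a unique solution, since
    [(v' + s v) * exp (- s z)] is constant for both square roots [s] of [lambda]
    ([cauchy_value0]); so the transformed trace is almost everywhere the
      expected
    profile. To bound the trace itself from below, pair its transform with the
    bump, move the pairing to the space side by [parseval], and apply the
    Cauchy-Schwarz inequality, the norm of the inverse transform of the bump
    being known by [plancherel] ([trace_lower_bound]). *)

Set Implicit Arguments.
Unset Strict Implicit.
Unset Printing Implicit Defensive.

Local Open Scope classical_set_scope.
Local Open Scope ring_scope.
Local Open Scope complex_scope.

(** * Integrals over products and bounded kernels *)

Section RealIntegrable.
Context {d : measure_display} {T : measurableType d} {R : realType}.

Lemma integrable_measurable (mu : {measure set T -> \bar R}) (f : T -> R) :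
  mu.-integrable setT (EFin \o f) -> measurable_fun setT f.
Proof. by move=> /measurable_int /measurable_EFinP. Qed.

Lemma le_integrable_real (mu : {measure set T -> \bar R}) (f g : T -> R) :
  measurable_fun setT f -> (forall x, `|f x| <= g x) ->
  mu.-integrable setT (EFin \o g) -> mu.-integrable setT (EFin \o f).
Proof.
move=> mf fg; apply: le_integrable => //; first exact/measurable_EFinP.
by move=> x _ /=; rewrite lee_fin (le_trans (fg x))// ler_norm.
Qed.

Lemma integrable_mul_bounded (mu : {measure set T -> \bar R}) (f c : T -> R)
    (M : R) :
  measurable_fun setT c -> (forall x, `|c x| <= M) ->
  mu.-integrable setT (EFin \o f) ->
  mu.-integrable setT (EFin \o (fun x => f x * c x)).
Proof.
move=> mc cM fi.
apply: (@le_integrable_real _ _ (fun x => M * `|f x|)).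
- by apply: measurable_funM => //; exact: integrable_measurable fi.
- by move=> x; rewrite normrM mulrC ler_wpM2r.
- have := @integrableZl _ _ _ mu setT measurableT M _ (integrable_abse fi).
  exact: eq_integrable.
Qed.

Lemma integrable_bounded_mul (mu : {measure set T -> \bar R}) (c f : T -> R)
    (M : R) :
  measurable_fun setT c -> (forall x, `|c x| <= M) ->
  mu.-integrable setT (EFin \o f) ->
  mu.-integrable setT (EFin \o (fun x => c x * f x)).
Proof.
move=> mc cM fi; have := integrable_mul_bounded mc cM fi.
by apply: eq_integrable => // x _ /=; rewrite mulrC.
Qed.

Lemma integrable_scale (mu : {measure set T -> \bar R}) (a : R) (f : T -> R) :
  mu.-integrable setT (EFin \o f) ->
  mu.-integrable setT (EFin \o (fun x => a * f x)).
Proof. by apply: (integrable_bounded_mul (M := `|a|)). Qed.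

End RealIntegrable.

Section Integration.
Context {d1 d2 : measure_display} {T1 : measurableType d1}
  {T2 : measurableType d2} {R : realType}.

Lemma measurable_comp_fst {d} {T : measurableType d} (f : T1 -> T) :
  measurable_fun setT f -> measurable_fun setT (fun z : T1 * T2 => f z.1).
Proof. by move=> mf; exact: (measurableT_comp mf). Qed.

Lemma measurable_comp_snd {d} {T : measurableType d} (f : T2 -> T) :
  measurable_fun setT f -> measurable_fun setT (fun z : T1 * T2 => f z.2).
Proof. by move=> mf; exact: (measurableT_comp mf). Qed.

(** The positive and negative parts of [f] have measurable integrals by
    Tonelli's theorem, and the integral of [f] is their difference. *)
Lemma measurable_param_integral (mu : {sigma_finite_measure set T2 -> \bar R})
    (f : T1 * T2 -> R) :
  measurable_fun setT f ->
  measurable_fun setT (fun x => \int[mu]_y f (x, y)).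
Proof.
move=> mf; have mF : measurable_fun setT (EFin \o f) by exact/measurable_EFinP.
apply: (measurableT_comp (fine_measurable measurableT)).
have -> : (fun x => (\int[mu]_y (f (x, y))%:E)%E) =
    ((fun x => \int[mu]_y ((EFin \o f)^\+ (x, y))) \-
     (fun x => \int[mu]_y ((EFin \o f)^\- (x, y))))%E.
  apply/funext => x; rewrite integralE.
  by congr (_ - _)%E; apply: eq_integral => y _; rewrite !(funeposE, funenegE).
apply: emeasurable_funB.
- apply: (measurable_fun_fubini_tonelli_F (EFin \o f)^\+%E) => //.
  exact: measurable_funepos.
- apply: (measurable_fun_fubini_tonelli_F (EFin \o f)^\-%E) => //.
  exact: measurable_funeneg.
Qed.

Context {m1 : {sigma_finite_measure set T1 -> \bar R}}
  {m2 : {sigma_finite_measure set T2 -> \bar R}}.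

Lemma integrable_tensor (f : T1 -> R) (g : T2 -> R) :
  m1.-integrable setT (EFin \o f) -> m2.-integrable setT (EFin \o g) ->
  (m1 \x m2)%E.-integrable setT (EFin \o (fun z => f z.1 * g z.2)).
Proof.
move=> fi gi.
have mf := integrable_measurable fi; have mg := integrable_measurable gi.
have mfg : measurable_fun setT (fun z : T1 * T2 => f z.1 * g z.2).
  apply: measurable_funM; first exact: measurable_comp_fst.
  exact: measurable_comp_snd.
apply/integrable12ltyP; first exact/measurable_EFinP.
rewrite /=; under eq_integral.
  move=> x _; under eq_integral do rewrite normrM EFinM.
  rewrite ge0_integralZl//; last first.
    by apply/measurable_EFinP; exact: measurableT_comp.
  over.
rewrite ge0_integralZr//=; last 2 first.
  by apply/measurable_EFinP; exact: measurableT_comp.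
  exact: integral_ge0.
have /integrableP[_ fy] := fi; have /integrableP[_ gy] := gi.
by apply: lte_mul_pinfty => //; [exact: integral_ge0|
  rewrite ge0_fin_numE//; exact: integral_ge0].
Qed.

Lemma Rintegral_swap (f : T1 * T2 -> R) :
  (m1 \x m2)%E.-integrable setT (EFin \o f) ->
  \int[m1]_x (\int[m2]_y f (x, y)) = \int[m2]_y (\int[m1]_x f (x, y)).
Proof.
move=> fi; have F := Fubini fi; have F1 := ae_integrable1 fi.
have F2 := ae_integrable2 fi.
have mf := integrable_measurable fi.
rewrite /Rintegral; congr fine.
transitivity (\int[m1]_x (\int[m2]_y (f (x, y))%:E))%E.
  apply: ae_eq_integral => //.
  - have := measurable_param_integral m2 mf.
    by move=> /measurable_EFinP; exact.
  - exact: (measurable_fubini_F fi).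
  - apply: filterS F1 => x xi _; rewrite /= fineK//.
    exact: (integrable_fin_num measurableT xi).
rewrite F; apply: ae_eq_integral => //.
- exact: (measurable_fubini_G fi).
- apply/measurable_EFinP.
  apply: (measurableT_comp (fine_measurable measurableT)).
  exact: (measurable_fubini_G fi).
- apply: filterS F2 => x xi _; rewrite /= fineK//.
  exact: (integrable_fin_num measurableT xi).
Qed.

(** With [c] a cosine or a sine of the phase this is the multiplication formula
    of Fourier analysis, from which the convolution formula, Plancherel's
    identity and Parseval's formula below all follow. *)
Lemma fubini_kernel (f : T1 -> R) (g : T2 -> R) (c : T1 * T2 -> R) :
  m1.-integrable setT (EFin \o f) -> m2.-integrable setT (EFin \o g) ->
  measurable_fun setT c -> (forall z, `|c z| <= 1) ->
  \int[m1]_x (f x * \int[m2]_y (g y * c (x, y))) =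
  \int[m2]_y (g y * \int[m1]_x (f x * c (x, y))).
Proof.
move=> fi gi mc c1.
have fgi : (m1 \x m2)%E.-integrable setT
    (EFin \o (fun z => f z.1 * g z.2 * c z)).
  by apply: integrable_mul_bounded c1 _ => //; exact: integrable_tensor.
have gci x : m2.-integrable setT (EFin \o (fun y => g y * c (x, y))).
  apply: integrable_mul_bounded (fun y => c1 (x, y)) gi.
  exact: measurableT_comp.
have fci y : m1.-integrable setT (EFin \o (fun x => f x * c (x, y))).
  apply: integrable_mul_bounded (fun x => c1 (x, y)) fi.
  exact: measurableT_comp.
have := Rintegral_swap fgi.
under eq_Rintegral => x _.
  under eq_Rintegral do rewrite /= -mulrA.
  rewrite RintegralZl//; over.
move=> ->; apply: eq_Rintegral => y _ /=.
rewrite -RintegralZl//; apply: eq_Rintegral => x _ /=; ring.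
Qed.

Lemma Rintegral_tensor (f : T1 -> R) (g : T2 -> R) :
  m1.-integrable setT (EFin \o f) -> m2.-integrable setT (EFin \o g) ->
  \int[(m1 \x m2)%E]_z (f z.1 * g z.2) = (\int[m1]_x f x) * (\int[m2]_y g y).
Proof.
move=> fi gi; have fgi := integrable_tensor fi gi.
rewrite [in LHS]/Rintegral -(integral12_prod_meas1 fgi) /fubini_F /=.
under eq_integral.
  move=> x _; under eq_integral do rewrite EFinM.
  rewrite integralZl//.
  rewrite -[X in (_ * X)%E]fineK ?(integrable_fin_num measurableT gi)//.
  over.
rewrite integralZr// fineM//; exact: (integrable_fin_num measurableT fi).
Qed.

End Integration.

Lemma Rintegral_dominated_cvg {d : measure_display} {T : measurableType d}
    {R : realType} (mu : {measure set T -> \bar R}) (f_ : nat -> T -> R)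
    (f g : T -> R) :
  (forall n, measurable_fun setT (f_ n)) ->
  (forall x, f_ n x @[n --> \oo] --> f x) ->
  mu.-integrable setT (EFin \o g) -> (forall n x, `|f_ n x| <= g x) ->
  \int[mu]_x f_ n x @[n --> \oo] --> \int[mu]_x f x.
Proof.
move=> mf ff gi fg.
have cf x : setT x -> (EFin \o f_ n) x @[n --> \oo] --> (EFin \o f) x.
  by move=> _; apply: cvg_EFin; [exact: nearW|exact: ff].
have mf_ n : measurable_fun setT (EFin \o f_ n) by exact/measurable_EFinP.
have fgE n x : setT x -> (`|(EFin \o f_ n) x| <= (EFin \o g) x)%E.
  by move=> _; rewrite lee_fin.
have mF : measurable_fun setT (EFin \o f) by exact: emeasurable_fun_cvg cf.
have [fi _] := @dominated_convergence _ _ _ mu setT measurableT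
  (fun n => EFin \o f_ n) _ (EFin \o g) mf_ mF (aeW _ cf) gi
  (aeW _ (fun x n => fgE n x)).
rewrite -(@fineK _ (\int[mu]_x (EFin \o f) x)%E); last first.
  exact: integrable_fin_num.
exact: fine_cvg.
Qed.

(** * Square-integrable complex functions *)

Section ComplexSquareIntegrable.
Context {d : measure_display} {T : measurableType d} {R : realType}.
Variable mu : {measure set T -> \bar R}.
Implicit Types (u v : T -> R[i]).

Definition abs2 u (x : T) : R := complex.Re (u x) ^+ 2 + complex.Im (u x) ^+ 2.

(** The real part of the Hermitian product of [u x] and [v x]. *)
Definition pairing u v (x : T) : R :=
  complex.Re (u x) * complex.Re (v x) + complex.Im (u x) * complex.Im (v x).

Lemma abs2_ge0 u x : 0 <= abs2 u x.
Proof. by rewrite addr_ge0 ?sqr_ge0. Qed.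

Lemma normc_sqrt_abs2 u x :
  ComplexField.Normc.normc (u x) = Num.sqrt (abs2 u x).
Proof. by rewrite /abs2; case: (u x). Qed.

Lemma measurable_abs2 u : cmeasurable setT u -> measurable_fun setT (abs2 u).
Proof. by case=> mr mi; apply: measurable_funD; exact: measurable_funX. Qed.

Lemma measurable_normc u : cmeasurable setT u ->
  measurable_fun setT (fun x => ComplexField.Normc.normc (u x)).
Proof.
move=> mu_; under eq_fun do rewrite normc_sqrt_abs2.
apply: (measurableT_comp (continuous_measurable_fun (@sqrt_continuous R))).
exact: measurable_abs2.
Qed.

Lemma L2normE u :
  L2norm mu setT u = ((\int[mu]_x (abs2 u x)%:E) `^ (2^-1))%E.
Proof.
rewrite /L2norm patch_setT unlock; congr (_ `^ _)%E.
apply: eq_integral => x _; rewrite normc_sqrt_abs2 /= ger0_norm ?sqrtr_ge0//.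
by rewrite powR_mulrn ?sqrtr_ge0// sqr_sqrtr// abs2_ge0.
Qed.

Lemma L2norm_ge0 u : (0 <= L2norm mu setT u)%E.
Proof. exact: Lnorm_ge0. Qed.

Lemma L2norm_sqrt u : mu.-integrable setT (EFin \o abs2 u) ->
  L2norm mu setT u = (Num.sqrt (\int[mu]_x abs2 u x))%:E.
Proof.
move=> ui; rewrite L2normE -[X in (X `^ _)%E]fineK; last first.
  exact: (integrable_fin_num measurableT ui).
rewrite poweR_EFin -/(Rintegral mu setT (abs2 u)) powR12_sqrt//.
by apply: Rintegral_ge0 => x _; exact: abs2_ge0.
Qed.

Lemma inL2_abs2 u : cmeasurable setT u ->
  mu.-integrable setT (EFin \o abs2 u) -> inL2 mu setT u.
Proof. by move=> mu_ ui; split => //; rewrite L2norm_sqrt// ltry. Qed.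

Lemma L2norm_cvg0 (u_ : nat -> T -> R[i]) :
  (forall n, mu.-integrable setT (EFin \o abs2 (u_ n))) ->
  \int[mu]_x abs2 (u_ n) x @[n --> \oo] --> (0 : R) ->
  L2norm mu setT (u_ n) @[n --> \oo] --> 0%E.
Proof.
move=> ui cu; under eq_cvg do rewrite L2norm_sqrt//.
apply: cvg_EFin; first exact: nearW.
rewrite -[X in _ --> X]sqrtr0.
exact: (cvg_comp _ _ cu (@sqrt_continuous R 0)).
Qed.

(** Lagrange's identity: the defect is the square of
    [Re u * Im v - Im u * Re v]. *)
Lemma normr_pairing_le u v x : `|pairing u v x| <=
  ComplexField.Normc.normc (u x) * ComplexField.Normc.normc (v x).
Proof.
rewrite !normc_sqrt_abs2 -sqrtrM ?abs2_ge0// -sqrtr_sqr ler_sqrt; last first.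
  by rewrite mulr_ge0 ?abs2_ge0.
rewrite /pairing /abs2.
set a := complex.Re _; set b := complex.Re _.
set c := complex.Im _; set e := complex.Im _.
rewrite -subr_ge0 (_ : _ - _ = (a * e - c * b) ^+ 2) ?sqr_ge0//; ring.
Qed.

Lemma measurable_pairing u v : cmeasurable setT u -> cmeasurable setT v ->
  measurable_fun setT (pairing u v).
Proof.
by case=> ? ? [? ?]; apply: measurable_funD; exact: measurable_funM.
Qed.

Lemma cauchy_schwarz u v : cmeasurable setT u -> cmeasurable setT v ->
  (\int[mu]_x `|pairing u v x|%:E <= L2norm mu setT u * L2norm mu setT v)%E.
Proof.
move=> mu_ mv.
have half : 2^-1 + 2^-1 = 1 :> R by rewrite -mulr2n -[2^-1 *+ 2]mulr_natr mulVf.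
have := hoelder mu (measurable_normc mu_) (measurable_normc mv)
  (ltr0n R 2) (ltr0n R 2) half.
rewrite /L2norm !patch_setT; apply: le_trans.
rewrite Lnorm1; apply: ge0_le_integral => //.
- apply/measurable_EFinP; have mp := measurable_pairing mu_ mv.
  exact: measurableT_comp mp.
- apply: measurableT_comp => //; apply/measurable_EFinP.
  by apply: measurable_funM; exact: measurable_normc.
- by move=> x _; rewrite lee_fin (le_trans (normr_pairing_le _ _ _))// ler_norm.
Qed.

Lemma integrable_pairing u v : inL2 mu setT u -> inL2 mu setT v ->
  mu.-integrable setT (EFin \o pairing u v).
Proof.
move=> [mu_ uy] [mv vy]; apply/integrableP; split.
  by apply/measurable_EFinP; exact: measurable_pairing.
apply: (le_lt_trans (cauchy_schwarz mu_ mv)).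
by apply: lte_mul_pinfty => //; [exact: L2norm_ge0|
  rewrite ge0_fin_numE//; exact: L2norm_ge0].
Qed.

Lemma Rintegral_pairing_le u v : inL2 mu setT u -> inL2 mu setT v ->
  (`|\int[mu]_x pairing u v x|%:E <= L2norm mu setT u * L2norm mu setT v)%E.
Proof.
move=> uL vL; have uvi := integrable_pairing uL vL.
rewrite EFin_normr_Rintegral//.
apply: le_trans (cauchy_schwarz uL.1 vL.1).
apply: le_abse_integral => //; exact: measurable_int uvi.
Qed.

(** The members of the sequence are not assumed square integrable, because the
    transforms that converge in [is_fourier] are not known to be so. *)
Lemma cvg_pairing (u_ : nat -> T -> R[i]) u v :
  (forall n, cmeasurable setT (u_ n)) ->
  (forall n, mu.-integrable setT (EFin \o pairing (u_ n) v)) ->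
  inL2 mu setT u -> inL2 mu setT v ->
  L2norm mu setT (fun x => u_ n x - u x) @[n --> \oo] --> 0%E ->
  \int[mu]_x pairing (u_ n) v x @[n --> \oo] --> \int[mu]_x pairing u v x.
Proof.
move=> mun pi1n uL vL cu.
have mB n : cmeasurable setT (fun x => u_ n x - u x).
  have [mr mi] := mun n; have [[mr' mi'] _] := uL.
  split; [under eq_fun do rewrite raddfB | under eq_fun do rewrite raddfB];
    exact: measurable_funB.
have vfin : L2norm mu setT v \is a fin_num.
  by rewrite ge0_fin_numE ?L2norm_ge0//; exact: vL.2.
have cuv : (L2norm mu setT (fun x => (u_ n x - u x)%R) * L2norm mu setT v)%E
    @[n --> \oo] --> 0%E.
  by rewrite -[X in _ --> X](mul0e (L2norm mu setT v)); exact: cvgeMr.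
apply/cvgrPdist_le => e e0.
have /fine_cvgP[finuv] := cuv.
move=> /cvgrPdist_le/(_ _ e0); apply: filterS2 finuv => n nfin.
rewrite sub0r normrN => ne.
have pi1 := pi1n n; have pi2 := integrable_pairing uL vL.
have pB x : pairing (fun x => u_ n x - u x) v x =
    pairing (u_ n) v x - pairing u v x.
  by rewrite /pairing !raddfB /=; ring.
have Bi : mu.-integrable setT (EFin \o pairing (fun x => u_ n x - u x) v).
  have := integrableB measurableT pi1 pi2; apply: eq_integrable => // x _ /=.
  by rewrite pB.
rewrite distrC -RintegralB//; under eq_Rintegral do rewrite -pB.
rewrite -lee_fin EFin_normr_Rintegral//.
apply: (le_trans (le_abse_integral _ _ (measurable_int _ Bi))) => //.
apply: (le_trans (cauchy_schwarz (mB n) vL.1)).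
by rewrite -[leLHS]fineK// lee_fin (le_trans (ler_norm _)).
Qed.

End ComplexSquareIntegrable.

(** * The exponential window and the Poisson kernel on the line *)

Section Poisson.
Context {R : realType}.
Implicit Types a b e t x : R.
Local Notation leb := (@lebesgue_measure R).

Lemma is_derive_linear b x : is_derive x 1 (fun y => b * y) b.
Proof.
have H := @is_deriveZ R R^o R^o id b x 1 1 (is_derive_id _ _).
by apply: (is_derive_eq H); rewrite /GRing.scale /= mulr1.
Qed.

Lemma is_derive_comp_linear (f : R -> R) b x df :
  is_derive (b * x) 1 f df -> is_derive x 1 (fun y => f (b * y)) (b * df).
Proof.
move=> fdf; have H := @is_derive1_comp R f (fun y => b * y) x _ _ fdf
  (is_derive_linear b x).
by apply: (is_derive_eq H); rewrite mulrC.
Qed.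

Lemma measurable_cos_linear b : measurable_fun setT (fun x : R => cos (b * x)).
Proof.
apply: (measurableT_comp (continuous_measurable_fun (@continuous_cos R))).
exact: measurable_funM.
Qed.

Lemma measurable_sin_linear b : measurable_fun setT (fun x : R => sin (b * x)).
Proof.
apply: (measurableT_comp (continuous_measurable_fun (@continuous_sin R))).
exact: measurable_funM.
Qed.

(** A primitive of [expR (- a x) * (1 + cos (b x))]. The summand [1] keeps the
    integrand nonnegative, as the improper fundamental theorem requires; the
    case [b = 0] then gives the integral to subtract. *)
Let expcos_primitive a b x :=
  expR (- a * x) * ((b * sin (b * x) - a * cos (b * x)) / (a ^+ 2 + b ^+ 2)
                    - a^-1).

Let is_derive_expcos_primitive a b x : 0 < a ->
  is_derive x 1 (expcos_primitive a b) (expR (- a * x) * (1 + cos (b * x))).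
Proof.
move=> a0.
have dE := is_derive_comp_linear (is_derive_expR (- a * x)).
have dS := is_derive_comp_linear (is_derive_sin (b * x)).
have dC := is_derive_comp_linear (is_derive_cos (b * x)).
have s0 : a ^+ 2 + b ^+ 2 != 0 by rewrite gt_eqF// ltr_wpDr ?sqr_ge0 ?exprn_gt0.
have H := is_deriveM dE (is_deriveB (is_deriveM (is_deriveB
  (is_deriveM (is_derive_cst b x 1) dS) (is_deriveM (is_derive_cst a x 1) dC))
  (is_derive_cst ((a ^+ 2 + b ^+ 2)^-1) x 1)) (is_derive_cst (a^-1) x 1)).
apply: (is_derive_eq H) => /=.
rewrite /GRing.scale /= !fctE /=; field.
by rewrite s0 gt_eqF.
Qed.

Let expcos_primitive_cvg a b : 0 < a ->
  expcos_primitive a b x @[x --> +oo] --> (0 : R).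
Proof.
move=> a0.
set C := `|b| * `|(a ^+ 2 + b ^+ 2)^-1| + `|a| * `|(a ^+ 2 + b ^+ 2)^-1| +
  `|a^-1|.
have C0 : 0 <= C by rewrite !addr_ge0// mulr_ge0.
have sc1 t : `|sin t| <= 1 /\ `|cos t| <= 1.
  by rewrite !ler_norml !sin_le1 !cos_le1 !sin_geN1 !cos_geN1.
have bd x : `|expcos_primitive a b x| <= C * expR (- (a * x)).
  rewrite /expcos_primitive normrM ger0_norm ?expR_ge0// mulrC mulNr.
  rewrite ler_wpM2r ?expR_ge0// (le_trans (ler_normB _ _))// lerD2r.
  rewrite normrM -mulrDl ler_wpM2r// (le_trans (ler_normB _ _))//.
  by rewrite !normrM lerD// ler_piMr//; case: (sc1 (b * x)).
have cE : C * expR (- (a * x)) @[x --> +oo] --> (0 : R).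
  rewrite -[X in _ --> X](mulr0 C); apply: cvgM; first exact: cvg_cst.
  apply: (@cvg_comp _ _ _ (fun x => a * x) (fun x => expR (- x)) _ +oo).
    exact: gt0_cvgMry.
  exact: cvgr_expR.
have cE' : - (C * expR (- (a * x))) @[x --> +oo] --> (0 : R).
  by rewrite -[X in _ --> X]oppr0; exact: cvgN.
apply: (squeeze_cvgr _ cE' cE); apply: nearW => x.
by rewrite -ler_norml.
Qed.

Lemma integral_expN_abs_1Dcos a b : 0 < a ->
  (\int[leb]_x (expR (- (a * `|x|)) * (1 + cos (b * x)))%:E =
   (2 * (a^-1 + a / (a ^+ 2 + b ^+ 2)))%:E)%E.
Proof.
move=> a0.
have cos1 t : 0 <= 1 + cos t by rewrite -lerBlDl sub0r cos_geN1.
have f0 x : 0 <= expR (- (a * `|x|)) * (1 + cos (b * x)).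
  by rewrite mulr_ge0// expR_ge0.
have cf : continuous (fun x => expR (- (a * `|x|)) * (1 + cos (b * x))).
  move=> x; apply: cvgM.
    apply: continuous_comp; last exact: continuous_expR.
    apply: cvgN; apply: cvgM; first exact: cvg_cst.
    exact: norm_continuous.
  apply: cvgD; first exact: cvg_cst.
  apply: continuous_comp; last exact: continuous_cos.
  by apply: cvgM; [exact: cvg_cst|exact: cvg_id].
rewrite ge0_symfun_integralT//; last first.
  by move=> x /=; rewrite normrN mulrN cosN.
rewrite EFinM; congr (_ * _)%E.
rewrite -set_itvcy.
transitivity (\int[leb]_(x in `[0%R, +oo[)
    (expR (- a * x) * (1 + cos (b * x)))%:E)%E.
  apply: eq_integral => x; rewrite inE /= in_itv /= andbT => x0.
  by rewrite ger0_norm// mulNr.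
rewrite (ge0_continuous_FTC2y _ _ (expcos_primitive_cvg b a0)).
- rewrite -EFinB; congr EFin.
  rewrite /expcos_primitive !mulr0 expR0 sin0 cos0 mulr0 sub0r mul1r mulr1.
  by rewrite sub0r mulNr opprB opprK.
- by move=> x _; rewrite mulr_ge0// expR_ge0.
- apply: continuous_subspaceT => x.
  apply: cvgM.
    apply: continuous_comp; last exact: continuous_expR.
    by apply: cvgM; [exact: cvg_cst|exact: cvg_id].
  apply: cvgD; first exact: cvg_cst.
  apply: continuous_comp; last exact: continuous_cos.
  by apply: cvgM; [exact: cvg_cst|exact: cvg_id].
- by move=> x _; exact: (@ex_derive _ _ _ _ _ _ _
    (is_derive_expcos_primitive b x a0)).
- apply: cvg_at_right_filter; apply/differentiable_continuous/derivable1_diffP.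
  exact: (@ex_derive _ _ _ _ _ _ _ (is_derive_expcos_primitive b 0 a0)).
- move=> x _; rewrite derive1E.
  exact: (@derive_val _ _ _ _ _ _ _ (is_derive_expcos_primitive b x a0)).
Qed.

Lemma integrable_expN_abs a : 0 < a ->
  leb.-integrable setT (EFin \o (fun x => expR (- (a * `|x|)))).
Proof.
move=> a0.
have mW : measurable_fun setT (fun x : R => expR (- (a * `|x|))).
  apply: measurableT_comp => //; apply: measurableT_comp => //.
  by apply: measurable_funM => //; exact: measurableT_comp.
apply: (@le_integrable_real _ _ _ leb _
    (fun x => expR (- (a * `|x|)) * (1 + cos (0 * x)))) => //.
  move=> x; rewrite ger0_norm ?expR_ge0// mul0r cos0 ler_peMr ?expR_ge0//.
  by rewrite lerDl.
apply/integrableP; split.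
  apply/measurable_EFinP; under eq_fun do rewrite mul0r cos0.
  exact: (measurable_funM mW (measurable_cst _)).
under eq_integral => x _.
  rewrite /= ger0_norm; last by rewrite mul0r cos0 mulr_ge0 ?expR_ge0.
  over.
by rewrite integral_expN_abs_1Dcos// ltry.
Qed.

Lemma Rintegral_expN_abs_cos a b : 0 < a ->
  \int[leb]_x (expR (- (a * `|x|)) * cos (b * x)) = 2 * a / (a ^+ 2 + b ^+ 2).
Proof.
move=> a0; have Wi := integrable_expN_abs a0.
have Wci c : leb.-integrable setT
    (EFin \o (fun x => expR (- (a * `|x|)) * cos (c * x))).
  apply: (@integrable_mul_bounded _ _ _ leb _ (fun x => cos (c * x)) 1) => //.
    exact: measurable_cos_linear.
  by move=> x; rewrite ler_norml cos_geN1 cos_le1.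
have E c : \int[leb]_x expR (- (a * `|x|)) +
    \int[leb]_x (expR (- (a * `|x|)) * cos (c * x)) =
    2 * (a^-1 + a / (a ^+ 2 + c ^+ 2)).
  rewrite -RintegralD// /Rintegral.
  under eq_integral do rewrite -[X in X + _]mulr1 -mulrDr.
  by rewrite integral_expN_abs_1Dcos.
have := E 0.
have -> : \int[leb]_x (expR (- (a * `|x|)) * cos (0 * x)) =
    \int[leb]_x expR (- (a * `|x|)).
  by apply: eq_Rintegral => x _; rewrite mul0r cos0 mulr1.
have := E b => Eb E0.
have W2 : \int[leb]_x expR (- (a * `|x|)) = 2 * a^-1.
  have : a^-1 + a / (a ^+ 2 + 0 ^+ 2) = a^-1 + a^-1.
    by field; rewrite gt_eqF.
  by move: E0 => + h; rewrite h; lra.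
by move: Eb; rewrite W2 mulrDr => /addrI ->; rewrite mulrA.
Qed.

(** Lebesgue measure is invariant under reflection, so the integral equals its
    own opposite. *)
Lemma Rintegral_odd (f : R -> R) : leb.-integrable setT (EFin \o f) ->
  (forall x, f (- x) = - f x) -> \int[leb]_x f x = 0.
Proof.
move=> fi fN.
have mN : measurable_fun setT (-%R : R -> R) by [].
have E : (\int[leb]_x (f x)%:E = \int[leb]_x (f (- x))%:E)%E.
  rewrite -[RHS](@integral_pushforward _ _ (measurableTypeR R)
    (measurableTypeR R) R -%R mN leb setT (EFin \o f))//.
  - by apply: eq_measure_integral => A mA _; exact/esym/lebesgue_measureN.
  - exact: (measurable_int _ fi).
  - rewrite preimage_setT; move/integrableN: fi; apply: eq_integrable => // x _.
    by rewrite /= fN.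
suff : \int[leb]_x f x = - \int[leb]_x f x by lra.
rewrite -mulN1r -RintegralZl// {1}/Rintegral E.
by congr fine; apply: eq_integral => x _; rewrite fN mulN1r.
Qed.

Lemma ge0_integral_translate (f : R -> R) s : continuous f ->
  (forall x, 0 <= f x) ->
  (\int[leb]_x (f (x - s))%:E = \int[leb]_x (f x)%:E)%E.
Proof.
move=> cf f0.
have dF x : is_derive x 1 (fun y : R => y - s) 1.
  have H := is_deriveB (is_derive_id x (1 : R)) (is_derive_cst s x 1).
  by apply: (is_derive_eq H); rewrite subr0.
have F1 : derive1 (fun y : R => y - s) = cst 1.
  by apply/funext => x; rewrite derive1E;
    exact: (@derive_val _ _ _ _ _ _ _ (dF x)).
rewrite [RHS](@increasing_ge0_integration_by_substitutionT _ (fun x => x -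
  s))//.
- by apply: eq_integral => x _; rewrite F1 /= !fctE mulr1.
- by move=> x y xy; rewrite ltrD2r.
- by rewrite F1 => x; exact: cvg_cst.
- by rewrite F1; exact: is_cvg_cst.
- by rewrite F1; exact: is_cvg_cst.
- exact: cvg_addrr_Ny.
- exact: cvg_addrr.
Qed.

Definition window e x := expR (- (2 * pi * e * `|x|)).

(** The Poisson kernel of the half-plane, of mass one; it is the Fourier
    transform of [window e]. *)
Definition poisson e t := e / (pi * (e ^+ 2 + t ^+ 2)).

Lemma window_gt0 e x : 0 < window e x. Proof. exact: expR_gt0. Qed.

Lemma window_le1 e x : 0 <= e -> window e x <= 1.
Proof.
by move=> e0; rewrite /window -expR0 ler_expR oppr_le0 !mulr_ge0 ?pi_ge0.
Qed.

Lemma integrable_window e : 0 < e ->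
  leb.-integrable setT (EFin \o window e).
Proof. by move=> e0; apply: integrable_expN_abs; rewrite !mulr_gt0 ?pi_gt0. Qed.

Lemma window_cos e t : 0 < e ->
  \int[leb]_x (window e x * cos (2 * pi * t * x)) = poisson e t.
Proof.
move=> e0; rewrite Rintegral_expN_abs_cos ?mulr_gt0 ?pi_gt0// /poisson.
have p0 : pi != 0 :> R by rewrite gt_eqF ?pi_gt0.
have s0 : e ^+ 2 + t ^+ 2 != 0 by rewrite gt_eqF// ltr_wpDr ?sqr_ge0 ?exprn_gt0.
move: (@pi R) p0 => p p0.
field; rewrite s0 p0 /=.
by rewrite !(exprMn _ (2 * p)) -mulrDr mulf_neq0// expf_neq0// mulf_neq0.
Qed.

Lemma integrable_window_sin e t : 0 < e ->
  leb.-integrable setT (EFin \o (fun x => window e x * sin (2 * pi * t * x))).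
Proof.
move=> e0; have Wi := integrable_window e0.
apply: (@integrable_mul_bounded _ _ _ leb _ (fun x => sin (2 * pi * t * x)) 1)
  => //.
  exact: measurable_sin_linear.
by move=> x; rewrite ler_norml sin_geN1 sin_le1.
Qed.

Lemma integrable_window_cos e t : 0 < e ->
  leb.-integrable setT (EFin \o (fun x => window e x * cos (2 * pi * t * x))).
Proof.
move=> e0; have Wi := integrable_window e0.
apply: (@integrable_mul_bounded _ _ _ leb _ (fun x => cos (2 * pi * t * x)) 1)
  => //.
  exact: measurable_cos_linear.
by move=> x; rewrite ler_norml cos_geN1 cos_le1.
Qed.

Lemma window_sin e t : 0 < e ->
  \int[leb]_x (window e x * sin (2 * pi * t * x)) = 0.
Proof.
move=> e0; apply: Rintegral_odd; first exact: integrable_window_sin.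
by move=> x; rewrite /window normrN mulrN sinN mulrN.
Qed.

Lemma poisson_ge0 e t : 0 <= e -> 0 <= poisson e t.
Proof.
move=> e0; rewrite divr_ge0// mulr_ge0 ?pi_ge0// addr_ge0 ?sqr_ge0//.
Qed.

Lemma poissonN e t : poisson e (- t) = poisson e t.
Proof. by rewrite /poisson sqrrN. Qed.

Lemma continuous_poisson e : 0 < e -> continuous (poisson e).
Proof.
move=> e0 t; apply: cvgM; first exact: cvg_cst.
apply: cvgV; first by rewrite gt_eqF// mulr_gt0 ?pi_gt0// ltr_wpDr ?sqr_ge0
  ?exprn_gt0.
apply: cvgM; first exact: cvg_cst.
apply: cvgD; first exact: cvg_cst.
exact: exprn_continuous.
Qed.

Lemma measurable_poisson e : 0 < e -> measurable_fun setT (poisson e).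
Proof.
by move=> e0; apply: continuous_measurable_fun; exact: continuous_poisson.
Qed.

Lemma integral_poisson e : 0 < e ->
  (\int[leb]_t (poisson e t)%:E = 1)%E.
Proof.
move=> e0.
have p0 : pi != 0 :> R by rewrite gt_eqF ?pi_gt0.
have dA x : is_derive x 1 (fun y => pi^-1 * atan (e^-1 * y)) (poisson e x).
  have H := is_derive_comp_linear (is_derive1_atan (e^-1 * x)).
  have H' := is_deriveZ (pi^-1) H.
  apply: (is_derive_eq H').
  rewrite /GRing.scale /= /poisson; move: (@pi R) p0 => p p0; field.
  rewrite p0 (gt_eqF e0) /=.
  by rewrite gt_eqF ?gt_eqF// ltr_wpDr ?sqr_ge0 ?exprn_gt0.
rewrite ge0_symfun_integralT//; last 3 first.
- by move=> x; rewrite poisson_ge0// ltW.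
- exact: continuous_poisson.
- by move=> x /=; rewrite poissonN.
rewrite -set_itvcy.
rewrite (@ge0_continuous_FTC2y _ _ (fun y => pi^-1 * atan (e^-1 * y)) _
  (pi^-1 * (pi / 2)))//.
- by rewrite mulr0 atan0 mulr0 sube0 -EFinM; congr EFin;
    move: (@pi R) p0 => p p0; field.
- by move=> x _; rewrite poisson_ge0// ltW.
- by apply: continuous_subspaceT; exact: continuous_poisson.
- apply: cvgM; first exact: cvg_cst.
  apply: (@cvg_comp _ _ _ (fun x => e^-1 * x) atan _ +oo);
    last exact: cvgy_atan.
  by apply: gt0_cvgMry; rewrite ?invr_gt0.
- have /derivable1_diffP/differentiable_continuous cA :=
    @ex_derive _ _ _ _ _ _ _ (dA 0).
  by apply: cvg_at_right_filter; exact: cA.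
- move=> x _; rewrite derive1E; exact: (@derive_val _ _ _ _ _ _ _ (dA x)).
Qed.

(** A bounded substitute for [t ^+ 2], against which [poisson e] has a finite
    integral that vanishes with [e]: this measures concentration at 0, although
    the second moment of the Poisson kernel is infinite. *)
Definition sat_sqr t : R := t ^+ 2 / (1 + t ^+ 2).

Lemma sat_sqr_ge0 t : 0 <= sat_sqr t.
Proof. by rewrite divr_ge0 ?addr_ge0 ?sqr_ge0. Qed.

Lemma continuous_sat_sqr : continuous sat_sqr.
Proof.
move=> t; apply: cvgM; first exact: exprn_continuous.
apply: cvgV; first by rewrite gt_eqF// ltr_wpDr ?sqr_ge0.
by apply: cvgD; [exact: cvg_cst|exact: exprn_continuous].
Qed.

Lemma measurable_sat_sqr : measurable_fun setT sat_sqr.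
Proof. apply: continuous_measurable_fun; exact: continuous_sat_sqr. Qed.

(** Since [t ^+ 2 <= e ^+ 2 + t ^+ 2], the integrand is at most [e] times the
    Poisson kernel of parameter 1. *)
Lemma integral_poisson_sat_sqr e : 0 < e ->
  (\int[leb]_t (poisson e t * sat_sqr t)%:E <= e%:E)%E.
Proof.
move=> e0.
have -> : (e%:E = \int[leb]_t (e%:E * (poisson 1 t)%:E))%E.
  rewrite ge0_integralZl ?integral_poisson ?mule1//.
  - by apply/measurable_EFinP; exact: measurable_poisson.
  - by move=> x _; rewrite lee_fin poisson_ge0.
  - by rewrite lee_fin ltW.
have P t : 0 < 1 + t ^+ 2 by rewrite ltr_wpDr ?sqr_ge0.
apply: ge0_le_integral => //.
- by move=> x _; rewrite lee_fin mulr_ge0 ?sat_sqr_ge0 ?poisson_ge0// ltW.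
- apply/measurable_EFinP; apply: measurable_funM.
    exact: measurable_poisson.
  exact: measurable_sat_sqr.
- apply: measurable_funeM.
  by apply/measurable_EFinP; exact: measurable_poisson.
- move=> t _; rewrite -EFinM lee_fin /poisson /sat_sqr expr1n.
  have s0 : 0 < e ^+ 2 + t ^+ 2 by rewrite ltr_wpDr ?sqr_ge0 ?exprn_gt0.
  rewrite -mulrA ler_pM2l// mul1r [X in _ <= X]invfM invfM -mulrA ler_pM2l
    ?invr_gt0 ?pi_gt0//.
  rewrite mulrA ler_piMl ?invr_ge0 ?(ltW (P t))//.
  by rewrite mulrC ler_pdivrMr// mul1r lerDr sqr_ge0.
Qed.

End Poisson.

(** * The window and the kernel in the plane *)

Section Plane.
Context {R : realType}.
Implicit Types (rho xi eta : R * R) (e : R) (h : R * R -> R).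
Notation leb := (@lebesgue_measure R).

Definition phase rho xi : R := 2 * pi * dotR2 rho xi.

Lemma phaseE rho xi :
  phase rho xi = 2 * pi * rho.1 * xi.1 + 2 * pi * rho.2 * xi.2.
Proof. by rewrite /phase /dotR2 mulrDr !mulrA. Qed.

Lemma phaseC rho xi : phase rho xi = phase xi rho.
Proof. by rewrite /phase /dotR2 (mulrC rho.1) (mulrC rho.2). Qed.

Lemma mu2_sigma_finite_setT : sigma_finite setT (@mu2 R).
Proof.
have /sigma_finiteP[F [TF ndF Foo]] := sigma_finiteT leb.
exists (fun n => F n `*` F n).
  rewrite -setXTT TF predeqE => -[x y]; split; last first.
    by move=> [n _ []/= ? ?]; split; exists n.
  move=> [/= [n _ Fnx] [k _ Fky]]; exists (maxn n k) => //; split.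
  - by move: x Fnx; exact/subsetPset/ndF/leq_maxl.
  - by move: y Fky; exact/subsetPset/ndF/leq_maxr.
move=> k; have [mF Fy] := Foo k.
split; first exact: measurableX.
have -> : mu2 (F k `*` F k) = (leb (F k) * leb (F k))%E.
  exact: product_measure1E.
by rewrite lte_mul_pinfty// ge0_fin_numE.
Qed.

(** The measure [mu2] under a name of its own, to which its sigma-finiteness can
    be attached; Fubini's theorem finds it there. *)
Definition plane_measure :
    set (measurableTypeR R * measurableTypeR R)%type -> \bar R :=
  (leb \x leb)%E.

HB.instance Definition _ := Measure.copy plane_measure (leb \x leb)%E.

HB.instance Definition _ := @Measure_isSigmaFinite.Build _ _ R plane_measure
  mu2_sigma_finite_setT.

Let mu2_sigma_finite :
    {sigma_finite_measure set (measurableTypeR R * measurableTypeR R)%type ->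
      \bar R} := plane_measure.

Lemma integrable_plane_tensor (f g : R -> R) :
  leb.-integrable setT (EFin \o f) -> leb.-integrable setT (EFin \o g) ->
  (@mu2 R).-integrable setT (EFin \o (fun x => f x.1 * g x.2)).
Proof. exact: integrable_tensor. Qed.

Lemma Rintegral_plane_tensor (f g : R -> R) :
  leb.-integrable setT (EFin \o f) -> leb.-integrable setT (EFin \o g) ->
  \int[@mu2 R]_x (f x.1 * g x.2) = (\int[leb]_x f x) * (\int[leb]_x g x).
Proof. exact: Rintegral_tensor. Qed.

Lemma plane_bounded_mul (c f : R * R -> R) (M : R) :
  measurable_fun setT c -> (forall x, `|c x| <= M) ->
  (@mu2 R).-integrable setT (EFin \o f) ->
  (@mu2 R).-integrable setT (EFin \o (fun x => c x * f x)).
Proof.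
by move=> mc cM fi; exact (@integrable_bounded_mul _ _ _ (@mu2 R) c f M mc cM
  fi).
Qed.

Lemma plane_mul_bounded (f c : R * R -> R) (M : R) :
  measurable_fun setT c -> (forall x, `|c x| <= M) ->
  (@mu2 R).-integrable setT (EFin \o f) ->
  (@mu2 R).-integrable setT (EFin \o (fun x => f x * c x)).
Proof.
by move=> mc cM fi; exact (@integrable_mul_bounded _ _ _ (@mu2 R) f c M mc cM
  fi).
Qed.

Lemma plane_fubini_kernel (f g : R * R -> R) (c : (R * R) * (R * R) -> R) :
  (@mu2 R).-integrable setT (EFin \o f) ->
  (@mu2 R).-integrable setT (EFin \o g) ->
  measurable_fun setT c -> (forall z, `|c z| <= 1) ->
  \int[@mu2 R]_x (f x * \int[@mu2 R]_y (g y * c (x, y))) =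
  \int[@mu2 R]_y (g y * \int[@mu2 R]_x (f x * c (x, y))).
Proof. exact: (@fubini_kernel _ _ _ _ R mu2_sigma_finite mu2_sigma_finite). Qed.

Lemma measurable_plane_param (f : (R * R) * (R * R) -> R) :
  measurable_fun setT f ->
  measurable_fun setT (fun x => \int[@mu2 R]_y f (x, y)).
Proof. exact: (@measurable_param_integral _ _ _ _ R mu2_sigma_finite). Qed.

Lemma plane_tonelli (f : (R * R) * (R * R) -> \bar R) :
  measurable_fun setT f -> (forall z, 0 <= f z)%E ->
  (\int[@mu2 R]_x \int[@mu2 R]_y f (x, y) =
   \int[@mu2 R]_y \int[@mu2 R]_x f (x, y))%E.
Proof.
exact: (@fubini_tonelli _ _ _ _ R mu2_sigma_finite mu2_sigma_finite).
Qed.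

Lemma measurable_phase :
  measurable_fun setT (fun z : (R * R) * (R * R) => phase z.1 z.2).
Proof.
apply: measurable_funM => //; apply: measurable_funD; apply: measurable_funM.
- exact: (measurableT_comp measurable_fst measurable_fst).
- exact: (measurableT_comp measurable_fst measurable_snd).
- exact: (measurableT_comp measurable_snd measurable_fst).
- exact: (measurableT_comp measurable_snd measurable_snd).
Qed.

Lemma measurable_cos_phase :
  measurable_fun setT (fun z : (R * R) * (R * R) => cos (phase z.1 z.2)).
Proof.
apply: (measurableT_comp (continuous_measurable_fun (@continuous_cos R))).
exact: measurable_phase.
Qed.

Lemma measurable_sin_phase :
  measurable_fun setT (fun z : (R * R) * (R * R) => sin (phase z.1 z.2)).
Proof.
apply: (measurableT_comp (continuous_measurable_fun (@continuous_sin R))).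
exact: measurable_phase.
Qed.

Lemma normr_cos_le1 (t : R) : `|cos t| <= 1.
Proof. by rewrite ler_norml cos_geN1 cos_le1. Qed.

Lemma normr_sin_le1 (t : R) : `|sin t| <= 1.
Proof. by rewrite ler_norml sin_geN1 sin_le1. Qed.

Lemma integrable_cos_phase (f : R * R -> R) rho :
  (@mu2 R).-integrable setT (EFin \o f) ->
  (@mu2 R).-integrable setT (EFin \o (fun x => f x * cos (phase rho x))).
Proof.
apply: integrable_mul_bounded (fun x => normr_cos_le1 _).
exact: (measurableT_comp measurable_cos_phase (pair1_measurable rho)).
Qed.

Lemma integrable_sin_phase (f : R * R -> R) rho :
  (@mu2 R).-integrable setT (EFin \o f) ->
  (@mu2 R).-integrable setT (EFin \o (fun x => f x * sin (phase rho x))).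
Proof.
apply: integrable_mul_bounded (fun x => normr_sin_le1 _).
exact: (measurableT_comp measurable_sin_phase (pair1_measurable rho)).
Qed.

Definition window2 e (x : R * R) : R := window e x.1 * window e x.2.

Definition poisson2 e rho eta : R :=
  poisson e (eta.1 - rho.1) * poisson e (eta.2 - rho.2).

Lemma integrable_window2 e : 0 < e ->
  (@mu2 R).-integrable setT (EFin \o window2 e).
Proof.
by move=> e0; apply: integrable_plane_tensor; exact: integrable_window.
Qed.

Lemma window2_ge0 e x : 0 <= window2 e x.
Proof. by rewrite mulr_ge0// ltW// window_gt0. Qed.

Lemma window2_le1 e x : 0 <= e -> window2 e x <= 1.
Proof. by move=> e0; rewrite mulr_ile1 ?window_le1// ltW// window_gt0. Qed.

(** The addition formula splits the cosine into products of functions of one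
    variable; the products of sines integrate to 0. *)
Lemma window2_cos e rho eta : 0 < e ->
  \int[@mu2 R]_x (window2 e x * cos (phase eta x - phase rho x)) =
  poisson2 e rho eta.
Proof.
move=> e0.
pose C s x := window e x * cos (2 * pi * s * x).
pose S s x := window e x * sin (2 * pi * s * x).
have Ci s : leb.-integrable setT (EFin \o C s) by exact: integrable_window_cos.
have Si s : leb.-integrable setT (EFin \o S s) by exact: integrable_window_sin.
transitivity (\int[@mu2 R]_x
    (C (eta.1 - rho.1) x.1 * C (eta.2 - rho.2) x.2 -
     S (eta.1 - rho.1) x.1 * S (eta.2 - rho.2) x.2)).
  apply: eq_Rintegral => x _; rewrite /window2 /C /S !phaseE.
  rewrite (_ : _ - _ = 2 * pi * (eta.1 - rho.1) * x.1 +
                       2 * pi * (eta.2 - rho.2) * x.2); last by ring.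
  rewrite cosD; ring.
rewrite RintegralB//; [|exact: integrable_plane_tensor..].
rewrite !Rintegral_plane_tensor//.
by rewrite !window_cos// !window_sin// mul0r subr0.
Qed.

Lemma window2_sin e rho eta : 0 < e ->
  \int[@mu2 R]_x (window2 e x * sin (phase eta x - phase rho x)) = 0.
Proof.
move=> e0.
pose C s x := window e x * cos (2 * pi * s * x).
pose S s x := window e x * sin (2 * pi * s * x).
have Ci s : leb.-integrable setT (EFin \o C s) by exact: integrable_window_cos.
have Si s : leb.-integrable setT (EFin \o S s) by exact: integrable_window_sin.
transitivity (\int[@mu2 R]_x
    (S (eta.1 - rho.1) x.1 * C (eta.2 - rho.2) x.2 +
     C (eta.1 - rho.1) x.1 * S (eta.2 - rho.2) x.2)).
  apply: eq_Rintegral => x _; rewrite /window2 /C /S !phaseE.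
  rewrite (_ : _ - _ = 2 * pi * (eta.1 - rho.1) * x.1 +
                       2 * pi * (eta.2 - rho.2) * x.2); last by ring.
  rewrite sinD; ring.
rewrite RintegralD//; [|exact: integrable_plane_tensor..].
rewrite !Rintegral_plane_tensor//.
by rewrite !window_sin// mul0r mulr0 addr0.
Qed.

Lemma continuous_translate (f : R -> R) (s : R) : continuous f ->
  continuous (fun t => f (t - s)).
Proof.
move=> cf t; apply: (@continuous_comp _ _ _ (fun u => u - s) f); last exact: cf.
by apply: cvgB; [exact: cvg_id|exact: cvg_cst].
Qed.

Lemma ge0_integrable_translate (f : R -> R) (s : R) : continuous f ->
  (forall t, 0 <= f t) -> (\int[leb]_t (f t)%:E < +oo)%E ->
  leb.-integrable setT (EFin \o (fun t => f (t - s))).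
Proof.
move=> cf f0 fy; apply/integrableP; split.
  apply/measurable_EFinP; apply: continuous_measurable_fun.
  exact: continuous_translate.
under eq_integral do rewrite /= ger0_norm//.
by rewrite ge0_integral_translate.
Qed.

Lemma integrable_poisson_translate e (s : R) : 0 < e ->
  leb.-integrable setT (EFin \o (fun t => poisson e (t - s))).
Proof.
move=> e0; apply: ge0_integrable_translate; first exact: continuous_poisson.
  by move=> t; rewrite poisson_ge0// ltW.
by rewrite integral_poisson// ltry.
Qed.

Lemma Rintegral_poisson_translate e (s : R) : 0 < e ->
  \int[leb]_t poisson e (t - s) = 1.
Proof.
move=> e0; rewrite /Rintegral ge0_integral_translate ?integral_poisson//.
  exact: continuous_poisson.
by move=> t; rewrite poisson_ge0// ltW.
Qed.

Let continuous_poisson_sat_sqr e : 0 < e ->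
  continuous (fun t : R => poisson e t * sat_sqr t).
Proof.
move=> e0 t.
by apply: cvgM; [exact: continuous_poisson|exact: continuous_sat_sqr].
Qed.

Let poisson_sat_sqr_ge0 e (t : R) : 0 < e -> 0 <= poisson e t * sat_sqr t.
Proof. by move=> e0; rewrite mulr_ge0 ?sat_sqr_ge0 ?poisson_ge0// ltW. Qed.

Lemma integrable_poisson_sat_sqr_translate e (s : R) : 0 < e ->
  leb.-integrable setT
    (EFin \o (fun t => poisson e (t - s) * sat_sqr (t - s))).
Proof.
move=> e0; apply: (ge0_integrable_translate (f := fun t => _ t * _ t)).
- exact: continuous_poisson_sat_sqr.
- by move=> t; exact: poisson_sat_sqr_ge0.
- by rewrite (le_lt_trans (integral_poisson_sat_sqr e0))// ltry.
Qed.

Lemma Rintegral_poisson_sat_sqr_translate e (s : R) : 0 < e ->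
  \int[leb]_t (poisson e (t - s) * sat_sqr (t - s)) <= e.
Proof.
move=> e0; rewrite /Rintegral.
rewrite (@ge0_integral_translate _ (fun t => poisson e t * sat_sqr t)).
- rewrite -lee_fin fineK ?integral_poisson_sat_sqr//.
  rewrite ge0_fin_numE ?(le_lt_trans (integral_poisson_sat_sqr e0)) ?ltry//.
  by apply: integral_ge0 => t _; rewrite lee_fin poisson_sat_sqr_ge0.
- exact: continuous_poisson_sat_sqr.
- by move=> t; exact: poisson_sat_sqr_ge0.
Qed.

Lemma poisson2_ge0 e rho eta : 0 <= e -> 0 <= poisson2 e rho eta.
Proof. by move=> e0; rewrite mulr_ge0 ?poisson_ge0. Qed.

Lemma poisson2C e rho eta : poisson2 e rho eta = poisson2 e eta rho.
Proof. by rewrite /poisson2 -poissonN opprB -[X in _ * X]poissonN opprB. Qed.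

Lemma measurable_poisson2 e : 0 < e ->
  measurable_fun setT (fun z : (R * R) * (R * R) => poisson2 e z.1 z.2).
Proof.
move=> e0; apply: measurable_funM;
  apply: (measurableT_comp (measurable_poisson e0)); apply: measurable_funB.
- exact: (measurableT_comp measurable_fst measurable_snd).
- exact: (measurableT_comp measurable_fst measurable_fst).
- exact: (measurableT_comp measurable_snd measurable_snd).
- exact: (measurableT_comp measurable_snd measurable_fst).
Qed.

Lemma integrable_poisson2 e rho : 0 < e ->
  (@mu2 R).-integrable setT (EFin \o poisson2 e rho).
Proof.
move=> e0.
exact: (integrable_plane_tensor (integrable_poisson_translate rho.1 e0)
  (integrable_poisson_translate rho.2 e0)).
Qed.

Lemma Rintegral_poisson2 e rho : 0 < e ->
  \int[@mu2 R]_eta poisson2 e rho eta = 1.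
Proof.
move=> e0.
rewrite (Rintegral_plane_tensor (integrable_poisson_translate rho.1 e0)
  (integrable_poisson_translate rho.2 e0)).
by rewrite !Rintegral_poisson_translate// mulr1.
Qed.

Lemma integral_poisson2 e rho : 0 < e ->
  (\int[@mu2 R]_eta (poisson2 e rho eta)%:E = 1)%E.
Proof.
move=> e0; have := Rintegral_poisson2 rho e0; rewrite /Rintegral => E.
rewrite -[LHS]fineK ?E//.
exact: (integrable_fin_num measurableT (integrable_poisson2 rho e0)).
Qed.

Lemma poisson2_sat_sqr1 e rho : 0 < e ->
  (@mu2 R).-integrable setT
    (EFin \o (fun eta => poisson2 e rho eta * sat_sqr (eta.1 - rho.1))) /\
  \int[@mu2 R]_eta (poisson2 e rho eta * sat_sqr (eta.1 - rho.1)) <= e.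
Proof.
move=> e0.
have E : (fun eta => poisson2 e rho eta * sat_sqr (eta.1 - rho.1)) =
  (fun eta => (fun t => poisson e (t - rho.1) * sat_sqr (t - rho.1)) eta.1 *
              (fun t => poisson e (t - rho.2)) eta.2).
  by apply/funext => eta; rewrite /poisson2 /= mulrAC.
have A := integrable_poisson_sat_sqr_translate rho.1 e0.
have B := integrable_poisson_translate rho.2 e0.
rewrite E; split; first exact: (integrable_plane_tensor A B).
rewrite (Rintegral_plane_tensor A B) Rintegral_poisson_translate// mulr1.
exact: Rintegral_poisson_sat_sqr_translate.
Qed.

Lemma poisson2_sat_sqr2 e rho : 0 < e ->
  (@mu2 R).-integrable setT
    (EFin \o (fun eta => poisson2 e rho eta * sat_sqr (eta.2 - rho.2))) /\
  \int[@mu2 R]_eta (poisson2 e rho eta * sat_sqr (eta.2 - rho.2)) <= e.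
Proof.
move=> e0.
have E : (fun eta => poisson2 e rho eta * sat_sqr (eta.2 - rho.2)) =
  (fun eta => (fun t => poisson e (t - rho.1)) eta.1 *
              (fun t => poisson e (t - rho.2) * sat_sqr (t - rho.2)) eta.2).
  by apply/funext => eta; rewrite /poisson2 /= mulrA.
have A := integrable_poisson_sat_sqr_translate rho.2 e0.
have B := integrable_poisson_translate rho.1 e0.
rewrite E; split; first exact: (integrable_plane_tensor B A).
rewrite (Rintegral_plane_tensor B A) Rintegral_poisson_translate// mul1r.
exact: Rintegral_poisson_sat_sqr_translate.
Qed.

End Plane.

(** * Poisson means converge in the L2 norm *)

Section Smoothing.
Context {R : realType}.
Variables (h : R * R -> R) (M : R).
Hypotheses (mh : measurable_fun setT h) (h_ge0 : forall x, 0 <= h x)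
  (h_le : forall x, h x <= M) (hi : (@mu2 R).-integrable setT (EFin \o h))
  (hc : continuous h).
Implicit Types (rho eta : R * R) (e : R).

Definition smooth e rho : R := \int[@mu2 R]_eta (h eta * poisson2 e rho eta).

Let M_ge0 : 0 <= M. Proof. by rewrite (le_trans (h_ge0 0)). Qed.

Let normr_h_le x : `|h x| <= M. Proof. by rewrite ger0_norm. Qed.

Lemma integrable_smooth_kernel e rho : 0 < e ->
  (@mu2 R).-integrable setT (EFin \o (fun eta => h eta * poisson2 e rho eta)).
Proof.
move=> e0.
exact: (plane_bounded_mul mh normr_h_le (integrable_poisson2 rho e0)).
Qed.

Lemma smooth_ge0 e rho : 0 < e -> 0 <= smooth e rho.
Proof.
by move=> e0; apply: Rintegral_ge0 => x _;
  rewrite mulr_ge0// poisson2_ge0// ltW.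
Qed.

Lemma smooth_le e rho : 0 < e -> smooth e rho <= M.
Proof.
move=> e0; have Ki := integrable_poisson2 rho e0.
rewrite -[leRHS]mulr1 -(Rintegral_poisson2 rho e0) -RintegralZl//.
apply: le_Rintegral => //.
- exact: integrable_smooth_kernel.
- exact: integrable_scale.
- by move=> x _; rewrite ler_wpM2r// poisson2_ge0// ltW.
Qed.

Let measurable_kernel e : 0 < e -> measurable_fun setT
  (fun z : (R * R) * (R * R) => h z.2 * poisson2 e z.1 z.2).
Proof.
move=> e0; apply: measurable_funM; last exact: measurable_poisson2.
exact: (measurableT_comp mh measurable_snd).
Qed.

Lemma measurable_smooth e : 0 < e -> measurable_fun setT (smooth e).
Proof.
by move=> e0; exact: (measurable_plane_param (measurable_kernel e0)).
Qed.

(** Far from [rho] the saturated squares exceed a positive constant, so they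
    absorb the oscillation of [h] there; near [rho] continuity does. *)
Let oscillation_le rho (dl : R) : 0 < dl -> exists C : R, forall eta,
  `|h eta - h rho| <=
    dl + C * (sat_sqr (eta.1 - rho.1) + sat_sqr (eta.2 - rho.2)).
Proof.
move=> dl0; have /cvgrPdist_le/(_ _ dl0) : h eta @[eta --> rho] --> h rho by
  exact: hc.
case=> -[A B] /= [[a /= a0 aA] [b /= b0 bB]] AB.
pose r := Num.min a b; have r0 : 0 < r by rewrite lt_min a0.
have sr0 : 0 < sat_sqr r by rewrite divr_gt0 ?exprn_gt0// ltr_wpDr ?sqr_ge0.
have sat_far t : r <= `|t| -> sat_sqr r <= sat_sqr t.
  move=> rt; have rt2 : r ^+ 2 <= t ^+ 2.
    by rewrite -(real_normK (num_real t)) lerXn2r// nnegrE ltW.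
  have P (s : R) : 0 < 1 + s ^+ 2 by rewrite ltr_wpDr ?sqr_ge0.
  rewrite /sat_sqr ler_pdivrMr// mulrAC ler_pdivlMr//.
  by rewrite !mulrDr !mulr1 [t ^+ 2 * _]mulrC lerD2r.
exists (M / sat_sqr r) => eta.
set s1 := sat_sqr (eta.1 - _); set s2 := sat_sqr (eta.2 - _).
have s10 : 0 <= s1 by exact: sat_sqr_ge0.
have s20 : 0 <= s2 by exact: sat_sqr_ge0.
have hM : `|h eta - h rho| <= M.
  rewrite ler_norml; have := h_ge0 eta; have := h_ge0 rho.
  by have := h_le eta; have := h_le rho; lra.
have far : sat_sqr r <= s1 + s2 ->
    `|h eta - h rho| <= dl + M / sat_sqr r * (s1 + s2).
  move=> H; rewrite (le_trans hM)// (@le_trans _ _ (M / sat_sqr r * (s1 +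
    s2)))//.
    by rewrite -mulrA ler_peMr// mulrC ler_pdivlMr// mul1r.
  by rewrite lerDr ltW.
have [near1|far1] := ltP `|eta.1 - rho.1| r; last first.
  by apply: far; rewrite ler_wpDr// sat_far.
have [near2|far2] := ltP `|eta.2 - rho.2| r; last first.
  by apply: far; rewrite ler_wpDl// sat_far.
rewrite distrC ler_wpDr// ?mulr_ge0 ?addr_ge0 ?invr_ge0 ?sat_sqr_ge0//.
apply: AB; split => /=.
- by apply: aA; rewrite /ball /= distrC (lt_le_trans near1)// ge_min lexx.
- by apply: bB; rewrite /ball /= distrC (lt_le_trans near2)// ge_min lexx orbT.
Qed.

Let smooth_dist_le rho (dl : R) : 0 < dl -> exists C : R, forall e, 0 < e ->
  `|smooth e rho - h rho| <= dl + `|C| * (e + e).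
Proof.
move=> dl0; have [C HC] := oscillation_le rho dl0; exists C => e e0.
have Ki := integrable_poisson2 rho e0.
have hKi := integrable_smooth_kernel rho e0.
have cKi (c : R) : (@mu2 R).-integrable setT
    (EFin \o (fun eta => c * poisson2 e rho eta)).
  exact: integrable_scale.
have [S1i S1] := poisson2_sat_sqr1 rho e0.
have [S2i S2] := poisson2_sat_sqr2 rho e0.
have -> : smooth e rho - h rho =
    \int[@mu2 R]_eta (h eta * poisson2 e rho eta - h rho * poisson2 e rho eta).
  by rewrite RintegralB// RintegralZl// Rintegral_poisson2// mulr1.
have di : (@mu2 R).-integrable setT (EFin \o (fun eta =>
    h eta * poisson2 e rho eta - h rho * poisson2 e rho eta)).
  have := integrableB measurableT hKi (cKi (h rho)); exact: eq_integrable.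
rewrite (le_trans (le_normr_Rintegral _ di))//.
have S12i : (@mu2 R).-integrable setT (EFin \o (fun eta =>
    poisson2 e rho eta * sat_sqr (eta.1 - rho.1) +
    poisson2 e rho eta * sat_sqr (eta.2 - rho.2))).
  have := integrableD measurableT S1i S2i; exact: eq_integrable.
have CSi : (@mu2 R).-integrable setT (EFin \o (fun eta =>
    `|C| * (poisson2 e rho eta * sat_sqr (eta.1 - rho.1) +
    poisson2 e rho eta * sat_sqr (eta.2 - rho.2)))).
  exact: integrable_scale.
apply: (@le_trans _ _ (\int[@mu2 R]_eta (dl * poisson2 e rho eta +
    `|C| * (poisson2 e rho eta * sat_sqr (eta.1 - rho.1) +
    poisson2 e rho eta * sat_sqr (eta.2 - rho.2))))).
  apply: le_Rintegral => //.
  - exact: integrable_norm.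
  - have := integrableD measurableT (cKi dl) CSi; exact: eq_integrable.
  - move=> eta _; rewrite -mulrBl normrM (ger0_norm (poisson2_ge0 _ _ (ltW
      e0))).
    rewrite (_ : dl * _ + _ = (dl + `|C| * (sat_sqr (eta.1 - rho.1) +
      sat_sqr (eta.2 - rho.2))) * poisson2 e rho eta); last by ring.
    rewrite ler_wpM2r ?poisson2_ge0 ?(ltW e0)//.
    rewrite (le_trans (HC eta))// lerD2l ler_wpM2r ?addr_ge0 ?sat_sqr_ge0//.
    exact: ler_norm.
rewrite RintegralD// !RintegralZl// Rintegral_poisson2// mulr1 RintegralD//.
by rewrite lerD2l ler_wpM2l// lerD.
Qed.

Lemma smooth_cvg rho : smooth (harmonic n) rho @[n --> \oo] --> h rho.
Proof.
apply/cvgrPdist_le => dl dl0.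
have [C HC] := smooth_dist_le rho (divr_gt0 dl0 (ltr0n _ 2)).
have cE : `|C| * (harmonic n + harmonic n) @[n --> \oo] --> (0 : R).
  rewrite -[X in _ --> X](mulr0 `|C|) -[X in _ * X](addr0 (0 : R)).
  apply: cvgM; first exact: cvg_cst.
  by apply: cvgD; exact: cvg_harmonic.
have /cvgrPdist_le/(_ _ (divr_gt0 dl0 (ltr0n _ 2))) := cE.
apply: filterS => n; rewrite sub0r normrN distrC => Hn.
rewrite (le_trans (HC _ (harmonic_gt0 n)))//.
have := le_trans (ler_norm _) Hn; lra.
Qed.

Lemma integrable_sqr : (@mu2 R).-integrable setT (EFin \o (fun x => h x ^+ 2)).
Proof. exact: (plane_mul_bounded mh normr_h_le hi). Qed.

(** Jensen's inequality for the probability density [poisson2 e rho]. *)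
Lemma smooth_sqr_le e rho : 0 < e ->
  smooth e rho ^+ 2 <= \int[@mu2 R]_eta (h eta ^+ 2 * poisson2 e rho eta).
Proof.
move=> e0; set H := smooth e rho.
have Ki := integrable_poisson2 rho e0.
have hKi := integrable_smooth_kernel rho e0.
have h2Ki : (@mu2 R).-integrable setT
    (EFin \o (fun eta => h eta ^+ 2 * poisson2 e rho eta)).
  have := plane_mul_bounded mh normr_h_le hKi.
  by apply: eq_integrable => // x _ /=; rewrite mulrAC.
have HhKi : (@mu2 R).-integrable setT
    (EFin \o (fun eta => (- 2 * H) * (h eta * poisson2 e rho eta))).
  exact: integrable_scale.
have HKi : (@mu2 R).-integrable setT
    (EFin \o (fun eta => H ^+ 2 * poisson2 e rho eta)).
  exact: integrable_scale.
have : 0 <= \int[@mu2 R]_eta ((h eta - H) ^+ 2 * poisson2 e rho eta).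
  apply: Rintegral_ge0 => x _.
  by rewrite mulr_ge0 ?sqr_ge0// poisson2_ge0// ltW.
have -> : \int[@mu2 R]_eta ((h eta - H) ^+ 2 * poisson2 e rho eta) =
  \int[@mu2 R]_eta (h eta ^+ 2 * poisson2 e rho eta +
    ((- 2 * H) * (h eta * poisson2 e rho eta) + H ^+ 2 * poisson2 e rho eta)).
  by apply: eq_Rintegral => x _; ring.
have HHi : (@mu2 R).-integrable setT (EFin \o (fun eta =>
  (- 2 * H) * (h eta * poisson2 e rho eta) + H ^+ 2 * poisson2 e rho eta)).
  have := integrableD measurableT HhKi HKi; exact: eq_integrable.
rewrite RintegralD// RintegralD// !RintegralZl// Rintegral_poisson2//.
rewrite -/(smooth e rho) -/H; lra.
Qed.

(** Integrate Jensen's inequality in [rho]; the kernel is symmetric, so it also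
    has mass one in [rho]. *)
Lemma integral_smooth_sqr_le e : 0 < e ->
  (\int[@mu2 R]_rho (smooth e rho ^+ 2)%:E <=
   \int[@mu2 R]_rho (h rho ^+ 2)%:E)%E.
Proof.
move=> e0.
have mF : measurable_fun setT (fun z : (R * R) * (R * R) =>
    (h z.2 ^+ 2 * poisson2 e z.1 z.2)%:E).
  apply/measurable_EFinP; apply: measurable_funM;
    last exact: measurable_poisson2.
  by apply: measurable_funX; exact: (measurableT_comp mh measurable_snd).
have F0 (z : (R * R) * (R * R)) : (0 <= (h z.2 ^+ 2 * poisson2 e z.1 z.2)%:E)%E.
  by rewrite lee_fin mulr_ge0 ?sqr_ge0// poisson2_ge0// ltW.
apply: (@le_trans _ _ (\int[@mu2 R]_rho \int[@mu2 R]_eta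
    (h eta ^+ 2 * poisson2 e rho eta)%:E)%E).
  apply: ge0_le_integral => //.
  - by move=> x _; rewrite lee_fin sqr_ge0.
  - by apply/measurable_EFinP; apply: measurable_funX; exact: measurable_smooth.
  - exact: (measurable_fun_fubini_tonelli_F (m2 := plane_measure) _ mF F0).
  - move=> rho _.
    have h2Ki : (@mu2 R).-integrable setT
        (EFin \o (fun eta => h eta ^+ 2 * poisson2 e rho eta)).
      have := plane_mul_bounded mh normr_h_le (integrable_smooth_kernel rho e0).
      by apply: eq_integrable => // x _ /=; rewrite mulrAC.
    rewrite -[leRHS]fineK; last exact: (integrable_fin_num measurableT h2Ki).
    by rewrite lee_fin; exact: smooth_sqr_le.
rewrite (plane_tonelli mF F0).
apply: ge0_le_integral => //.
- by move=> x _; exact: integral_ge0.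
- exact: (measurable_fun_fubini_tonelli_G (m1 := plane_measure) _ mF F0).
- by apply/measurable_EFinP; exact: measurable_funX.
- move=> eta _ /=; under eq_integral do rewrite poisson2C EFinM.
  rewrite ge0_integralZl ?lee_fin ?sqr_ge0//.
  + by rewrite integral_poisson2// mule1.
  + by apply/measurable_EFinP; exact: (integrable_measurable
      (integrable_poisson2 _ _)).
  + by move=> x _; rewrite lee_fin poisson2_ge0// ltW.
Qed.

Lemma integrable_smooth_sqr e : 0 < e ->
  (@mu2 R).-integrable setT (EFin \o (fun x => smooth e x ^+ 2)).
Proof.
move=> e0; apply/integrableP; split.
  by apply/measurable_EFinP; apply: measurable_funX; exact: measurable_smooth.
under eq_integral do rewrite /= ger0_norm ?sqr_ge0//.
apply: (le_lt_trans (integral_smooth_sqr_le e0)).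
have /integrableP[_] := integrable_sqr.
by under eq_integral do rewrite /= ger0_norm ?sqr_ge0//.
Qed.

Lemma integrable_smooth_dist e : 0 < e ->
  (@mu2 R).-integrable setT (EFin \o (fun x => (smooth e x - h x) ^+ 2)).
Proof.
move=> e0; have Si := integrable_smooth_sqr e0.
have gi : (@mu2 R).-integrable setT
    (EFin \o (fun x => 2 * smooth e x ^+ 2 + 2 * h x ^+ 2)).
  have := integrableD measurableT (integrable_scale 2 Si)
    (integrable_scale 2 integrable_sqr).
  exact: eq_integrable.
apply: (le_integrable_real _ _ gi).
  apply: measurable_funX; apply: measurable_funB => //;
    exact: measurable_smooth.
move=> x; rewrite ger0_norm ?sqr_ge0//.
by have := sqr_ge0 (smooth e x + h x); rewrite -subr_ge0; nra.
Qed.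

Lemma integrable_mul_smooth e : 0 < e ->
  (@mu2 R).-integrable setT (EFin \o (fun x => h x * smooth e x)).
Proof.
move=> e0; apply: plane_mul_bounded hi.
  exact: measurable_smooth.
by move=> x; rewrite ger0_norm ?smooth_ge0//; exact: smooth_le.
Qed.

Lemma mul_smooth_cvg :
  \int[@mu2 R]_x (h x * smooth (harmonic n) x) @[n --> \oo] -->
  \int[@mu2 R]_x (h x ^+ 2).
Proof.
apply: (@Rintegral_dominated_cvg _ _ R (@mu2 R)
  (fun n x => h x * smooth (harmonic n) x) (fun x => h x ^+ 2)
  (fun x => h x * M)).
- move=> n; apply: measurable_funM => //; apply: measurable_smooth.
  exact: harmonic_gt0.
- by move=> x; apply: cvgM; [exact: cvg_cst|exact: smooth_cvg].
- by apply: (plane_mul_bounded (M := `|M|) _ _ hi).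
- move=> n x; rewrite normrM !ger0_norm ?smooth_ge0 ?harmonic_gt0//.
  by rewrite ler_wpM2l// smooth_le// harmonic_gt0.
Qed.

(** By Jensen the smoothed function has no larger norm, so expanding the square
    leaves only the pairing with [h], which converges. *)
Lemma smooth_L2_cvg :
  \int[@mu2 R]_x (smooth (harmonic n) x - h x) ^+ 2 @[n --> \oo] --> (0 : R).
Proof.
pose u n := 2 * (\int[@mu2 R]_x (h x ^+ 2) -
  \int[@mu2 R]_x (h x * smooth (harmonic n) x)).
have cu : u n @[n --> \oo] --> (0 : R).
  rewrite -[X in _ --> X](mulr0 (2 : R)); apply: cvgM; first exact: cvg_cst.
  rewrite -(subrr (\int[@mu2 R]_x (h x ^+ 2))).
  by apply: cvgB; [exact: cvg_cst|exact: mul_smooth_cvg].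
apply: (squeeze_cvgr _ (cvg_cst 0) cu); apply: nearW => n.
have e0 : 0 < harmonic n :> R by exact: harmonic_gt0.
apply/andP; split; first by apply: Rintegral_ge0 => x _; exact: sqr_ge0.
have Si := integrable_smooth_sqr e0; have hSi := integrable_mul_smooth e0.
have h2i := integrable_sqr.
have -> : \int[@mu2 R]_x (smooth (harmonic n) x - h x) ^+ 2 =
  \int[@mu2 R]_x (smooth (harmonic n) x ^+ 2 +
   ((- 2) * (h x * smooth (harmonic n) x) + h x ^+ 2)).
  by apply: eq_Rintegral => x _; ring.
have chSi : (@mu2 R).-integrable setT
    (EFin \o (fun x => (- 2) * (h x * smooth (harmonic n) x))).
  exact: integrable_scale.
have ri : (@mu2 R).-integrable setT
    (EFin \o (fun x => (- 2) * (h x * smooth (harmonic n) x) + h x ^+ 2)).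
  have := integrableD measurableT chSi h2i; exact: eq_integrable.
rewrite RintegralD// RintegralD// RintegralZl// /u.
suff : \int[@mu2 R]_x (smooth (harmonic n) x ^+ 2) <= \int[@mu2 R]_x (h x ^+ 2).
  by lra.
apply: fine_le; [exact: (integrable_fin_num measurableT Si)|
  exact: (integrable_fin_num measurableT h2i)|exact: integral_smooth_sqr_le].
Qed.

End Smoothing.

(** * Fourier inversion and Plancherel's identity *)

Section Fourier.
Context {R : realType}.
Implicit Types (rho xi eta : R * R) (h : R * R -> R) (v : R * R -> R[i]).

Definition cos_transform h xi : R :=
  \int[@mu2 R]_eta (h eta * cos (phase eta xi)).

Definition sin_transform h xi : R :=
  \int[@mu2 R]_eta (h eta * sin (phase eta xi)).

Definition inverse_fourier h xi : R[i] :=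
  cos_transform h xi +i* sin_transform h xi.

Lemma fourierL1E v rho :
  fourierL1 v rho =
  (\int[@mu2 R]_xi (complex.Re (v xi) * cos (phase rho xi) +
                    complex.Im (v xi) * sin (phase rho xi))) +i*
  (\int[@mu2 R]_xi (complex.Im (v xi) * cos (phase rho xi) -
                    complex.Re (v xi) * sin (phase rho xi))).
Proof.
rewrite /fourierL1 /cintegral; congr (_ +i* _);
  apply: eq_Rintegral => xi _; rewrite -/(phase rho xi) /expi cosN sinN;
  case: (v xi) => a b /=; ring.
Qed.

Lemma measurable_transform (trig : R -> R) h :
  measurable_fun setT trig -> measurable_fun setT h ->
  measurable_fun setT
    (fun xi => \int[@mu2 R]_eta (h eta * trig (phase eta xi))).
Proof.
move=> mt mh.
apply: (@measurable_plane_param R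
  (fun z : (R * R) * (R * R) => h z.2 * trig (phase z.2 z.1))).
apply: measurable_funM; first exact: (measurableT_comp mh measurable_snd).
apply: (measurableT_comp mt); under eq_fun do rewrite phaseC.
exact: measurable_phase.
Qed.

Lemma measurable_inverse_fourier h :
  measurable_fun setT h -> cmeasurable setT (inverse_fourier h).
Proof.
move=> mh; split; apply: measurable_transform => //;
  apply: continuous_measurable_fun;
  [exact: continuous_cos|exact: continuous_sin].
Qed.

Lemma cos_transform_le h xi : (@mu2 R).-integrable setT (EFin \o h) ->
  `|cos_transform h xi| <= \int[@mu2 R]_eta `|h eta|.
Proof.
move=> hi; under [cos_transform h xi]eq_Rintegral do rewrite phaseC.
have ci := integrable_cos_phase xi hi.
rewrite (le_trans (le_normr_Rintegral _ ci))//.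
apply: le_Rintegral => //; [exact: integrable_norm|exact: integrable_norm|].
by move=> eta _; rewrite normrM ler_piMr// normr_cos_le1.
Qed.

Lemma sin_transform_le h xi : (@mu2 R).-integrable setT (EFin \o h) ->
  `|sin_transform h xi| <= \int[@mu2 R]_eta `|h eta|.
Proof.
move=> hi; under [sin_transform h xi]eq_Rintegral do rewrite phaseC.
have ci := integrable_sin_phase xi hi.
rewrite (le_trans (le_normr_Rintegral _ ci))//.
apply: le_Rintegral => //; [exact: integrable_norm|exact: integrable_norm|].
by move=> eta _; rewrite normrM ler_piMr// normr_sin_le1.
Qed.

Section Inversion.
Variables (h : R * R -> R) (M : R).
Hypotheses (mh : measurable_fun setT h) (h_ge0 : forall x, 0 <= h x)
  (h_le : forall x, h x <= M) (hi : (@mu2 R).-integrable setT (EFin \o h))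
  (hc : continuous h).

Local Notation C := (cos_transform h).
Local Notation S := (sin_transform h).
Local Notation v := (inverse_fourier h).

Let hcos_int xi : (@mu2 R).-integrable setT
  (EFin \o (fun eta => h eta * cos (phase eta xi))).
Proof.
have := integrable_cos_phase xi hi.
by apply: eq_integrable => // eta _ /=; rewrite phaseC.
Qed.

Let hsin_int xi : (@mu2 R).-integrable setT
  (EFin \o (fun eta => h eta * sin (phase eta xi))).
Proof.
have := integrable_sin_phase xi hi.
by apply: eq_integrable => // eta _ /=; rewrite phaseC.
Qed.

Let transform_comb xi (a b : R) :
  C xi * a + S xi * b =
  \int[@mu2 R]_eta (h eta * (cos (phase eta xi) * a + sin (phase eta xi) * b)).
Proof.
rewrite -!RintegralZr// -RintegralD//.
- by apply: eq_Rintegral => eta _; ring.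
- have := integrable_scale a (hcos_int xi).
  by apply: eq_integrable => // eta _ /=; rewrite mulrC.
- have := integrable_scale b (hsin_int xi).
  by apply: eq_integrable => // eta _ /=; rewrite mulrC.
Qed.

(** The integrable functions that approximate [inverse_fourier h] in the
    definition of [is_fourier]; the inverse transform itself need not be
    integrable. *)
Definition windowed e xi : R[i] :=
  (window2 e xi * cos_transform h xi) +i* (window2 e xi * sin_transform h xi).

Let measurable_swap_phase (trig : R -> R) rho : measurable_fun setT trig ->
  measurable_fun setT (fun z : (R * R) * (R * R) =>
    trig (phase z.2 z.1 - phase rho z.1)).
Proof.
move=> mt; apply: (measurableT_comp mt); apply: measurable_funB.
  under eq_fun do rewrite phaseC; exact: measurable_phase.
apply: (measurableT_comp (f := fun x => phase rho x) _ measurable_fst).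
exact: (measurableT_comp measurable_phase (pair1_measurable rho)).
Qed.

(** Multiplying by the window before transforming replaces [h] by its Poisson
    mean, since the window transforms into the Poisson kernel. *)
Lemma fourier_windowed e rho : 0 < e ->
  fourierL1 (windowed e) rho = (smooth h e rho)%:C.
Proof.
move=> e0; rewrite fourierL1E; have Wi := integrable_window2 e0.
have mcos : measurable_fun setT (@cos R).
  by apply: continuous_measurable_fun; exact: continuous_cos.
have msin : measurable_fun setT (@sin R).
  by apply: continuous_measurable_fun; exact: continuous_sin.
congr (_ +i* _).
- transitivity (\int[@mu2 R]_xi (window2 e xi *
    \int[@mu2 R]_eta (h eta * cos (phase eta xi - phase rho xi)))).
    apply: eq_Rintegral => xi _ /=.
    rewrite -!(mulrA (window2 e xi)) -mulrDr transform_comb; congr (_ * _).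
    by apply: eq_Rintegral => eta _; rewrite cosB.
  rewrite (plane_fubini_kernel Wi hi (measurable_swap_phase rho mcos)
    (fun z => normr_cos_le1 _)) /=.
  by apply: eq_Rintegral => eta _; rewrite window2_cos.
- transitivity (\int[@mu2 R]_xi (window2 e xi *
    \int[@mu2 R]_eta (h eta * sin (phase eta xi - phase rho xi)))).
    apply: eq_Rintegral => xi _ /=.
    rewrite -!(mulrA (window2 e xi)) -mulrBr; congr (_ * _).
    rewrite addrC -mulrN transform_comb.
    by apply: eq_Rintegral => eta _; rewrite sinB; congr (_ * _); ring.
  rewrite (plane_fubini_kernel Wi hi (measurable_swap_phase rho msin)
    (fun z => normr_sin_le1 _)) /=.
  under eq_Rintegral do rewrite window2_sin// mulr0.
  by rewrite /Rintegral integral0.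
Qed.

Let B := \int[@mu2 R]_eta `|h eta|.

Let windowed_int e : 0 < e ->
  (@mu2 R).-integrable setT (EFin \o (fun xi => window2 e xi * C xi)) /\
  (@mu2 R).-integrable setT (EFin \o (fun xi => window2 e xi * S xi)).
Proof.
move=> e0; have [mC mS] := measurable_inverse_fourier mh.
split; apply: (plane_mul_bounded (M := B)) (integrable_window2 e0) => // xi.
  exact: cos_transform_le.
exact: sin_transform_le.
Qed.

(** Pairing the windowed inverse transform with the inverse transform itself and
    moving the latter to the frequency side leaves [h] against its Poisson
    mean. *)
Let window_abs2 e : 0 < e ->
  (@mu2 R).-integrable setT (EFin \o (fun xi => window2 e xi * abs2 v xi)) /\
  \int[@mu2 R]_xi (window2 e xi * abs2 v xi) =
  \int[@mu2 R]_eta (h eta * smooth h e eta).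
Proof.
move=> e0; have [WC WS] := windowed_int e0.
have [mC mS] := measurable_inverse_fourier mh.
have WCC : (@mu2 R).-integrable setT
    (EFin \o (fun xi => window2 e xi * C xi * C xi)).
  by apply: (plane_mul_bounded (M := B)) WC => // xi; exact: cos_transform_le.
have WSS : (@mu2 R).-integrable setT
    (EFin \o (fun xi => window2 e xi * S xi * S xi)).
  by apply: (plane_mul_bounded (M := B)) WS => // xi; exact: sin_transform_le.
have E xi : window2 e xi * abs2 v xi =
    window2 e xi * C xi * C xi + window2 e xi * S xi * S xi.
  by rewrite /abs2 /=; ring.
split.
  have := integrableD measurableT WCC WSS.
  by apply: eq_integrable => // xi _ /=; rewrite E.
under eq_Rintegral do rewrite E.
rewrite RintegralD//.
have mc : measurable_fun setT
    (fun z : (R * R) * (R * R) => cos (phase z.2 z.1)).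
  by under eq_fun do rewrite phaseC; exact: measurable_cos_phase.
have ms : measurable_fun setT
    (fun z : (R * R) * (R * R) => sin (phase z.2 z.1)).
  by under eq_fun do rewrite phaseC; exact: measurable_sin_phase.
have -> : \int[@mu2 R]_xi (window2 e xi * C xi * C xi) =
    \int[@mu2 R]_eta (h eta *
      \int[@mu2 R]_xi (window2 e xi * C xi * cos (phase eta xi))).
  exact: (plane_fubini_kernel WC hi mc (fun z => normr_cos_le1 _)).
have -> : \int[@mu2 R]_xi (window2 e xi * S xi * S xi) =
    \int[@mu2 R]_eta (h eta *
      \int[@mu2 R]_xi (window2 e xi * S xi * sin (phase eta xi))).
  exact: (plane_fubini_kernel WS hi ms (fun z => normr_sin_le1 _)).
have cosi eta := integrable_cos_phase eta WC.
have sini eta := integrable_sin_phase eta WS.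
rewrite -RintegralD//.
- apply: eq_Rintegral => eta _; rewrite -mulrDr; congr (_ * _).
  have := congr1 (@complex.Re R) (fourier_windowed eta e0).
  by rewrite fourierL1E /= => <-; rewrite RintegralD.
- apply: (plane_mul_bounded (M := \int[@mu2 R]_xi `|window2 e xi * C xi|)) hi.
    apply: (@measurable_plane_param R (fun z : (R * R) * (R * R) =>
      window2 e z.2 * C z.2 * cos (phase z.1 z.2))).
    apply: measurable_funM; last exact: measurable_cos_phase.
    exact: (measurableT_comp (integrable_measurable WC) measurable_snd).
  move=> eta; have := cos_transform_le eta WC.
  by under [cos_transform _ _]eq_Rintegral do rewrite phaseC.
- apply: (plane_mul_bounded (M := \int[@mu2 R]_xi `|window2 e xi * S xi|)) hi.
    apply: (@measurable_plane_param R (fun z : (R * R) * (R * R) =>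
      window2 e z.2 * S z.2 * sin (phase z.1 z.2))).
    apply: measurable_funM; last exact: measurable_sin_phase.
    exact: (measurableT_comp (integrable_measurable WS) measurable_snd).
  move=> eta; have := sin_transform_le eta WS.
  by under [sin_transform _ _]eq_Rintegral do rewrite phaseC.
Qed.

Let window2_harmonic_le n m xi : (n <= m)%N ->
  window2 (harmonic n) xi <= window2 (harmonic m) xi.
Proof.
move=> nm; have H t : window (harmonic n) t <= window (harmonic m) t :> R.
  rewrite ler_expR lerN2 ler_wpM2r// ler_wpM2l ?mulr_ge0 ?pi_ge0//=.
  by rewrite lef_pV2 ?posrE ?ltr0n// ler_nat.
by rewrite /window2 ler_pM// ltW// window_gt0.
Qed.

Let window2_cvg xi : window2 (harmonic n) xi @[n --> \oo] --> (1 : R).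
Proof.
have H t : window (harmonic n) t @[n --> \oo] --> (1 : R).
  have cz : - (2 * pi * harmonic n * `|t|) @[n --> \oo] --> (0 : R).
    rewrite -[X in _ --> X]oppr0; apply: cvgN.
    rewrite -[X in _ --> X](mul0r `|t|); apply: cvgM; last exact: cvg_cst.
    rewrite -[X in _ --> X](mulr0 (2 * pi)); apply: cvgM; first exact: cvg_cst.
    exact: cvg_harmonic.
  by rewrite -(@expR0 R); exact: (cvg_comp _ _ cz (@continuous_expR R 0)).
by rewrite -[X in _ --> X](mulr1 (1 : R)); apply: cvgM.
Qed.

(** Let [e] decrease to 0 in [window_abs2]: the left-hand side converges by
    monotone convergence, the right-hand side by dominated convergence. *)
Lemma plancherel :
  (@mu2 R).-integrable setT (EFin \o abs2 v) /\
  \int[@mu2 R]_xi abs2 v xi = \int[@mu2 R]_eta (h eta ^+ 2).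
Proof.
have mv := measurable_abs2 (measurable_inverse_fourier mh).
have E : (\int[@mu2 R]_xi (abs2 v xi)%:E =
    (\int[@mu2 R]_eta (h eta ^+ 2))%:E)%E.
  have c1 := @cvg_monotone_convergence _ _ R (@mu2 R) setT measurableT
    (fun n xi => (window2 (harmonic n) xi * abs2 v xi)%:E).
  have {}c1 : (\int[@mu2 R]_xi (window2 (harmonic n) xi * abs2 v xi)%:E)%E
      @[n --> \oo] --> (\int[@mu2 R]_xi (abs2 v xi)%:E)%E.
    rewrite (_ : (\int[@mu2 R]_xi (abs2 v xi)%:E)%E =
      (\int[@mu2 R]_xi limn (fun n => (window2 (harmonic n) xi * abs2 v
        xi)%:E))%E).
      apply: c1.
      - move=> n; apply/measurable_EFinP.
        exact: (integrable_measurable (window_abs2 (harmonic_gt0 n)).1).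
      - by move=> n xi _; rewrite lee_fin mulr_ge0 ?window2_ge0 ?abs2_ge0.
      - move=> xi _ n m nm; rewrite lee_fin ler_wpM2r ?abs2_ge0//.
        exact: window2_harmonic_le.
    apply: eq_integral => xi _; apply/esym/cvg_lim => //.
    apply: cvg_EFin; first exact: nearW.
    rewrite -[X in _ --> X]mul1r; apply: cvgM; last exact: cvg_cst.
    exact: window2_cvg.
  have c2 : (\int[@mu2 R]_xi (window2 (harmonic n) xi * abs2 v xi)%:E)%E
      @[n --> \oo] --> (\int[@mu2 R]_eta (h eta ^+ 2))%:E.
    rewrite (_ : (fun n => _) = (fun n =>
        (\int[@mu2 R]_eta (h eta * smooth h (harmonic n) eta))%:E)).
      apply: cvg_EFin; first exact: nearW.
      exact: (mul_smooth_cvg mh h_ge0 h_le hi hc).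
    apply/funext => n; have [wi <-] := window_abs2 (harmonic_gt0 n).
    by rewrite /Rintegral fineK//; exact: (integrable_fin_num measurableT wi).
  exact: (cvg_unique _ c1 c2).
split; last by rewrite /Rintegral E.
apply/integrableP; split; first exact/measurable_EFinP.
under eq_integral do rewrite /= ger0_norm ?abs2_ge0//.
by rewrite E ltry.
Qed.

(** As the window [W] takes values in [0, 1], [(1 - W) ^+ 2 <= 1 - W]; so the
    squared distance is at most the part of the norm not yet captured by
    [window_abs2]. *)
Let windowed_dist_cvg :
  \int[@mu2 R]_xi abs2 (fun x => windowed (harmonic n) x - v x) xi
    @[n --> \oo] --> (0 : R) /\
  forall n, (@mu2 R).-integrable setT
    (EFin \o abs2 (fun x => windowed (harmonic n) x - v x)).
Proof.
have [vi vE] := plancherel.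
have mv := measurable_abs2 (measurable_inverse_fourier mh).
have E n xi : abs2 (fun x => windowed (harmonic n) x - v x) xi =
    (1 - window2 (harmonic n) xi) ^+ 2 * abs2 v xi.
  by rewrite /abs2 !raddfB /=; ring.
have W01 n (xi : R * R) : 0 <= (window2 (harmonic n) xi : R) <= 1.
  by rewrite window2_ge0 window2_le1 ?harmonic_ge0.
have di n : (@mu2 R).-integrable setT
    (EFin \o (fun xi => abs2 v xi - window2 (harmonic n) xi * abs2 v xi)).
  have := integrableB measurableT vi (window_abs2 (harmonic_gt0 n)).1.
  exact: eq_integrable.
have le n xi : abs2 (fun x => windowed (harmonic n) x - v x) xi <=
    abs2 v xi - window2 (harmonic n) xi * abs2 v xi.
  rewrite E -[X in _ <= X - _]mul1r -mulrBl ler_wpM2r ?abs2_ge0//.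
  by have := W01 n xi; nra.
have ai n : (@mu2 R).-integrable setT
    (EFin \o abs2 (fun x => windowed (harmonic n) x - v x)).
  apply: (le_integrable_real _ _ (di n)); last first.
    by move=> xi; rewrite ger0_norm ?abs2_ge0.
  rewrite (_ : abs2 _ =
      fun xi => (1 - window2 (harmonic n) xi) ^+ 2 * abs2 v xi); last first.
    by apply/funext => xi; exact: E.
  have mW := integrable_measurable (integrable_window2 (harmonic_gt0 n)).
  apply: measurable_funM; last exact: mv.
  apply: measurable_funX; apply: measurable_funB; last exact: mW.
  exact: measurable_cst.
split => //.
have c0 : \int[@mu2 R]_xi abs2 v xi -
    \int[@mu2 R]_eta (h eta * smooth h (harmonic n) eta) @[n --> \oo] --> (0 :
      R).
  rewrite vE -[X in _ --> X](subrr (\int[@mu2 R]_eta (h eta ^+ 2))).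
  apply: cvgB; first exact: cvg_cst.
  exact: (mul_smooth_cvg mh h_ge0 h_le hi hc).
apply: (squeeze_cvgr _ (cvg_cst 0) c0); apply: nearW => n.
rewrite Rintegral_ge0 /=; last by move=> xi _; exact: abs2_ge0.
have [wi <-] := window_abs2 (harmonic_gt0 n).
rewrite -RintegralB//; apply: le_Rintegral => //; [exact: ai|by move=> xi _;
  exact: le].
Qed.

(** The windowed inverse transforms converge to [inverse_fourier h] by
    [windowed_dist_cvg], and their transforms, the Poisson means of [h],
    converge to [h] by [smooth_L2_cvg]. *)
Lemma fourier_inversion : is_fourier v (fun rho => (h rho)%:C).
Proof.
have [vi _] := plancherel.
have [dcvg di] := windowed_dist_cvg.
have mvc := measurable_inverse_fourier mh.
split.
- exact: inL2_abs2.
- apply: inL2_abs2; first by split => //=; exact: measurable_cst.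
  have := integrable_sqr mh h_ge0 h_le hi.
  by apply: eq_integrable => // x _ /=; rewrite /abs2 /= expr0n /= addr0.
exists (fun n => windowed (harmonic n)); split.
- move=> n; have [WC WS] := windowed_int (harmonic_gt0 n).
  split; first by split.
  apply: inL2_abs2.
    by split; [exact: (integrable_measurable WC)|exact: (integrable_measurable
      WS)].
  apply: (@le_integrable_real _ _ _ (@mu2 R) _ (abs2 v)) => //.
    apply: measurable_abs2.
    by split; [exact: (integrable_measurable WC)|exact: (integrable_measurable
      WS)].
  move=> xi; rewrite ger0_norm ?abs2_ge0//.
  rewrite (_ : abs2 _ _ = window2 (harmonic n) xi ^+ 2 * abs2 v xi); last first.
    by rewrite /abs2 /=; ring.
  by rewrite ler_piMl ?abs2_ge0// exprn_ile1 ?window2_ge0 ?window2_le1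
    ?harmonic_ge0.
- exact: L2norm_cvg0.
- have E n rho : abs2 (fun rho => fourierL1 (windowed (harmonic n)) rho - (h
    rho)%:C)
      rho = (smooth h (harmonic n) rho - h rho) ^+ 2.
    rewrite /abs2 fourier_windowed ?harmonic_gt0// !raddfB /=.
    by rewrite subr0 expr0n /= addr0.
  apply: L2norm_cvg0.
    move=> n.
    have := integrable_smooth_dist mh h_ge0 h_le hi (harmonic_gt0 n).
    by apply: eq_integrable => // rho _; exact: (congr1 EFin (esym (E n rho))).
  have := smooth_L2_cvg mh h_ge0 h_le hi hc.
  rewrite (_ : (fun n => _) = (fun n => \int[@mu2 R]_rho abs2
    (fun rho => fourierL1 (windowed (harmonic n)) rho - (h rho)%:C) rho)) //.
  by apply/funext => n; apply: eq_Rintegral => rho _; exact: (esym (E n rho)).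
Qed.

End Inversion.

End Fourier.

(** * Parseval's formula *)

Section Parseval.
Context {R : realType}.
Implicit Types (rho xi : R * R) (t : R * R -> R) (u uh : R * R -> R[i]).

Lemma measurable_fourierL1 u : cmeasurable setT u ->
  cmeasurable setT (fourierL1 u).
Proof.
move=> [mr mi].
have mr2 : measurable_fun setT
    (fun z : (R * R) * (R * R) => complex.Re (u z.2)).
  exact: (measurableT_comp mr measurable_snd).
have mi2 : measurable_fun setT
    (fun z : (R * R) * (R * R) => complex.Im (u z.2)).
  exact: (measurableT_comp mi measurable_snd).
split; under eq_fun do rewrite fourierL1E /=.
- apply: (@measurable_plane_param R (fun z : (R * R) * (R * R) =>
    complex.Re (u z.2) * cos (phase z.1 z.2) +
    complex.Im (u z.2) * sin (phase z.1 z.2))).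
  by apply: measurable_funD; apply: measurable_funM => //;
    [exact: measurable_cos_phase|exact: measurable_sin_phase].
- apply: (@measurable_plane_param R (fun z : (R * R) * (R * R) =>
    complex.Im (u z.2) * cos (phase z.1 z.2) -
    complex.Re (u z.2) * sin (phase z.1 z.2))).
  by apply: measurable_funB; apply: measurable_funM => //;
    [exact: measurable_cos_phase|exact: measurable_sin_phase].
Qed.

(** Fubini's theorem moves the transform from [u] to the test function [t]. *)
Let pairing_fourierL1 u t : cintegrable mu2 setT u ->
  (@mu2 R).-integrable setT (EFin \o t) ->
  (@mu2 R).-integrable setT
    (EFin \o pairing (fourierL1 u) (fun rho => (t rho)%:C)) /\
  \int[@mu2 R]_rho pairing (fourierL1 u) (fun rho => (t rho)%:C) rho =
  \int[@mu2 R]_xi pairing u (inverse_fourier t) xi.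
Proof.
move=> [ri ii] ti.
pose Ur rho := \int[@mu2 R]_xi (complex.Re (u xi) * cos (phase rho xi)).
pose Ui rho := \int[@mu2 R]_xi (complex.Im (u xi) * sin (phase rho xi)).
have mt : measurable_fun setT t by exact: integrable_measurable ti.
have mr := integrable_measurable ri; have mi := integrable_measurable ii.
have tUr : (@mu2 R).-integrable setT (EFin \o (fun rho => t rho * Ur rho)).
  apply: (plane_mul_bounded (M := \int[@mu2 R]_xi `|complex.Re (u xi)|)) ti.
    apply: (@measurable_plane_param R (fun z : (R * R) * (R * R) =>
      complex.Re (u z.2) * cos (phase z.1 z.2))).
    apply: measurable_funM; last exact: measurable_cos_phase.
    exact: (measurableT_comp mr measurable_snd).
  move=> rho; have := cos_transform_le rho ri.
  by under [cos_transform _ _]eq_Rintegral do rewrite phaseC.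
have tUi : (@mu2 R).-integrable setT (EFin \o (fun rho => t rho * Ui rho)).
  apply: (plane_mul_bounded (M := \int[@mu2 R]_xi `|complex.Im (u xi)|)) ti.
    apply: (@measurable_plane_param R (fun z : (R * R) * (R * R) =>
      complex.Im (u z.2) * sin (phase z.1 z.2))).
    apply: measurable_funM; last exact: measurable_sin_phase.
    exact: (measurableT_comp mi measurable_snd).
  move=> rho; have := sin_transform_le rho ii.
  by under [sin_transform _ _]eq_Rintegral do rewrite phaseC.
have E rho : pairing (fourierL1 u) (fun rho => (t rho)%:C) rho =
    t rho * Ur rho + t rho * Ui rho.
  rewrite /pairing fourierL1E /= mulr0 addr0 RintegralD//;
    first by rewrite -/(Ur rho) -/(Ui rho); ring.
    exact: integrable_cos_phase.
  exact: integrable_sin_phase.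
split.
  have := integrableD measurableT tUr tUi.
  by apply: eq_integrable => // rho _; exact: (congr1 EFin (esym (E rho))).
have [mC mS] := measurable_inverse_fourier mt.
transitivity (\int[@mu2 R]_rho (t rho * Ur rho + t rho * Ui rho)).
  by apply: eq_Rintegral => rho _; exact: E.
rewrite RintegralD//.
have mc : measurable_fun setT
    (fun z : (R * R) * (R * R) => cos (phase z.2 z.1)).
  by under eq_fun do rewrite phaseC; exact: measurable_cos_phase.
have ms : measurable_fun setT
    (fun z : (R * R) * (R * R) => sin (phase z.2 z.1)).
  by under eq_fun do rewrite phaseC; exact: measurable_sin_phase.
have := plane_fubini_kernel ri ti mc (fun z => normr_cos_le1 _).
rewrite /= -/Ur => <-.
have := plane_fubini_kernel ii ti ms (fun z => normr_sin_le1 _).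
rewrite /= -/Ui => <-.
rewrite -RintegralD//.
- apply: (plane_mul_bounded (M := \int[@mu2 R]_rho `|t rho|)) ri => // xi.
  exact: cos_transform_le.
- apply: (plane_mul_bounded (M := \int[@mu2 R]_rho `|t rho|)) ii => // xi.
  exact: sin_transform_le.
Qed.

(** Both sides are limits of the multiplication formula along the integrable
    functions that approximate [u]. Testing against [t] bounds [u] from below in
    terms of [uh] alone. *)
Lemma parseval u uh t : is_fourier u uh ->
  (@mu2 R).-integrable setT (EFin \o t) ->
  inL2 mu2 setT (fun rho => (t rho)%:C) -> inL2 mu2 setT (inverse_fourier t) ->
  \int[@mu2 R]_rho pairing uh (fun rho => (t rho)%:C) rho =
  \int[@mu2 R]_xi pairing u (inverse_fourier t) xi.
Proof.
move=> [uL uhL [w [wL wu wuh]]] ti tL vL.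
have c1 : \int[@mu2 R]_rho pairing (fourierL1 (w n)) (fun rho => (t rho)%:C) rho
    @[n --> \oo] --> \int[@mu2 R]_rho pairing uh (fun rho => (t rho)%:C) rho.
  apply: (cvg_pairing _ _ uhL tL wuh) => n.
    exact: measurable_fourierL1 (wL n).2.1.
  exact: (pairing_fourierL1 (wL n).1 ti).1.
have c2 : \int[@mu2 R]_xi pairing (w n) (inverse_fourier t) xi
    @[n --> \oo] --> \int[@mu2 R]_xi pairing u (inverse_fourier t) xi.
  apply: (cvg_pairing _ _ uL vL wu) => n; first exact: (wL n).2.1.
  exact: integrable_pairing (wL n).2 vL.
have E : (fun n => \int[@mu2 R]_rho
      pairing (fourierL1 (w n)) (fun rho => (t rho)%:C) rho) =
    (fun n => \int[@mu2 R]_xi pairing (w n) (inverse_fourier t) xi).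
  by apply/funext => n; exact: (pairing_fourierL1 (wL n).1 ti).2.
by move: c1; rewrite E => c1; exact: cvg_unique c1 c2.
Qed.

End Parseval.

(** * The Cauchy problem at a fixed frequency *)

Section Cauchy.
Context {R : realType}.
Implicit Types (d l a z G : R).

Definition cosh a : R := (expR a + expR (- a)) / 2.

Definition sinh a : R := (expR a - expR (- a)) / 2.

Definition real_ac_derivative d (v w : R -> R) : Prop :=
  (@mu1 R).-integrable `[0, d] (EFin \o w) /\
  forall z, 0 <= z <= d -> v z = v 0 + \int[@mu1 R]_(x in `[0, z]) w x.

Lemma ac_derivativeP d (v w : R -> R[i]) :
  ac_derivative d v w <->
  real_ac_derivative d (fun z => complex.Re (v z)) (fun z => complex.Re (w z))
    /\
  real_ac_derivative d (fun z => complex.Im (v z)) (fun z => complex.Im (w z)).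
Proof.
split=> [[[ri ii] vE]|[[ri rE] [ii iE]]].
  by split; split => // z zd; rewrite vE// raddfD.
split => // z zd; rewrite /cintegral.
move: (rE z zd) (iE z zd).
case: (v z) => a b /=; case: (v 0) => a0 b0 /= -> ->.
by [].
Qed.

Lemma ae_neq a : {ae (@mu1 R), forall z, z != a}.
Proof.
exists [set a]; split => //; first exact: lebesgue_measure_set1.
by move=> z /= /negP; rewrite negbK => /eqP.
Qed.

Section Uniqueness.
Variables (d l G : R) (v v1 v2 : R -> R).
Hypotheses (d_gt0 : 0 < d) (l_gt0 : 0 < l)
  (vv1 : real_ac_derivative d v v1) (v1v2 : real_ac_derivative d v1 v2)
  (eqn : {ae (@mu1 R), forall z, 0 < z < d -> v2 z = l * v z})
  (vd : v d = G) (v1d : v1 d = 0).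

Let V z := v 0 + \int[@mu1 R]_(x in `[0, z]) v1 x.
Let V1 z := v1 0 + \int[@mu1 R]_(x in `[0, z]) v2 x.

Let vE z : 0 <= z <= d -> v z = V z. Proof. by move/vv1.2. Qed.
Let v1E z : 0 <= z <= d -> v1 z = V1 z. Proof. by move/v1v2.2. Qed.

Let contV : {within `[0, d], continuous V}.
Proof.
move=> x; apply: cvgD; first exact: cvg_cst.
exact: (parameterized_integral_continuous (ltW d_gt0) vv1.1).
Qed.

Let contV1 : {within `[0, d], continuous V1}.
Proof.
move=> x; apply: cvgD; first exact: cvg_cst.
exact: (parameterized_integral_continuous (ltW d_gt0) v1v2.1).
Qed.

Let int_cont (f : R -> R) : {within `[0, d], continuous f} ->
  (@mu1 R).-integrable `[0, d] (EFin \o f).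
Proof.
by move=> cf; apply: continuous_compact_integrable => //;
  exact: segment_compact.
Qed.

(** [f] is only integrable, but its primitive on [0, d] is also that of the
    continuous function [g], to which the fundamental theorem applies. *)
Let is_derive_primitive (f g : R -> R) (c z : R) :
  {within `[0, d], continuous g} ->
  (forall x, 0 <= x <= d -> \int[@mu1 R]_(t in `[0, x]) f t =
                          \int[@mu1 R]_(t in `[0, x]) g t) ->
  z \in `]0, d[ ->
  is_derive z 1 (fun x => c + \int[@mu1 R]_(t in `[0, x]) f t) (g z).
Proof.
move=> cg fg zd; have := zd; rewrite in_itv /= => /andP[z0 zd'].
have cz : {for z, continuous g}.
  by have /(continuous_within_itvP _ d_gt0)[+ _ _] := cg; apply.
have [dg gE] := continuous_FTC1_closed zd' (int_cont cg) z0 cz.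
have Dg : is_derive z 1 (fun x => \int[@mu1 R]_(t in `[0, x]) g t) (g z).
  by apply: DeriveDef => //; rewrite -derive1E.
have H := is_deriveD (is_derive_cst c z 1) Dg.
rewrite add0r in H.
apply: near_eq_is_derive H.
near=> x; rewrite /= !fctE /=; congr (_ + _); apply/esym/fg.
have : x \in `]0, d[ by near: x; exact: near_in_itvoo.
by rewrite in_itv /= => /andP[x0 xd]; rewrite !ltW.
Unshelve. all: by end_near. Qed.

Let dV z : z \in `]0, d[ -> is_derive z 1 V (V1 z).
Proof.
apply: is_derive_primitive => // x /andP[x0 xd].
apply: eq_Rintegral => t; rewrite inE /= in_itv /= => /andP[t0 tx].
by apply: v1E; rewrite t0 (le_trans tx).
Qed.

Let dV1 z : z \in `]0, d[ -> is_derive z 1 V1 (l * V z).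
Proof.
apply: (is_derive_primitive (g := fun x => l * V x)).
  by move=> x; apply: cvgM; [exact: cvg_cst|exact: contV].
move=> x /andP[x0 xd]; congr fine.
have sub : `[0, x] `<=` `[0, d] by apply: subset_itvl; rewrite bnd_simp.
apply: ae_eq_integral => //.
- have := measurable_int _ v1v2.1; exact: measurable_funS.
- have ci : {within `[0, d], continuous (fun x => l * V x)}.
    by move=> y; apply: cvgM; [exact: cvg_cst|exact: contV].
  have := measurable_int _ (int_cont ci); exact: measurable_funS.
- have n0 := ae_neq 0; have nd := ae_neq d.
  move: n0 nd eqn; apply: filterS3; first exact: (ae_filter_ringOfSetsType mu1).
  move=> t t0 td teq.
  rewrite /= in_itv /= => /andP[t0' tx].
  have tr : 0 < t < d by rewrite !lt_neqAle eq_sym t0 t0' td (le_trans tx).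
  by rewrite teq// vE// (ltW (andP tr).1) (ltW (andP tr).2).
Qed.

Let conserved (s : R) : s ^+ 2 = l ->
  (V1 d + s * V d) * expR (- s * d) = V1 0 + s * V 0.
Proof.
move=> sl.
pose E z := (V1 z + s * V z) * expR (- s * z).
have dE z : z \in `]0, d[ -> is_derive z 1 E 0.
  move=> zd.
  have H := is_deriveM (is_deriveD (dV1 zd)
    (is_deriveM (is_derive_cst s z 1) (dV zd)))
    (is_derive_comp_linear (is_derive_expR (- s * z))).
  apply: (is_derive_eq H); rewrite /GRing.scale /= !fctE /= -sl; ring.
have cE : {within `[0, d], continuous E}.
  move=> x; apply: cvgM.
    apply: cvgD; first exact: contV1.
    by apply: cvgM; [exact: cvg_cst|exact: contV].
  apply: continuous_subspaceT => y.
  apply: continuous_comp; last exact: continuous_expR.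
  by apply: cvgM; [exact: cvg_cst|exact: cvg_id].
have [c _] := MVT d_gt0 dE cE.
rewrite mul0r => /eqP; rewrite subr_eq0 => /eqP.
by rewrite /E mulr0 expR0 mulr1.
Qed.

(** The quantities [(v' + s v) exp (- s z)], for [s] either square root of [l],
    are constant; their values at [d] determine [v 0]. *)
Lemma cauchy_value0 : v 0 = G * cosh (Num.sqrt l * d).
Proof.
set a := Num.sqrt l; have a2 : a ^+ 2 = l by rewrite sqr_sqrtr// ltW.
have a0 : a != 0 by rewrite gt_eqF// sqrtr_gt0.
have Nd : 0 <= d <= d by rewrite ltW /=.
have N0 : (0 : R) <= 0 <= d by rewrite lexx ltW.
have h1 : a * G * expR (- (a * d)) = v1 0 + a * v 0.
  have := conserved a2; rewrite -(v1E Nd) -(v1E N0) -(vE Nd) -(vE N0).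
  by rewrite v1d vd add0r mulNr.
have h2 : - a * G * expR (a * d) = v1 0 + - a * v 0.
  have := @conserved (- a); rewrite sqrrN => /(_ a2).
  by rewrite -(v1E Nd) -(v1E N0) -(vE Nd) -(vE N0) v1d vd add0r opprK.
have : 2 * a * v 0 = 2 * a * (G * cosh (a * d)).
  rewrite /cosh; move: h1 h2.
  set p := expR (a * d); set q := expR _ => h1 h2; lra.
by apply: mulfI; rewrite mulf_neq0.
Qed.

End Uniqueness.

(** The fundamental theorem of calculus, including the degenerate interval at
    [z = 0]. *)
Lemma real_ac_derivative_C1 d (f f' : R -> R) :
  (forall z, is_derive z 1 f (f' z)) -> continuous f' ->
  real_ac_derivative d f f'.
Proof.
move=> ff' cf'.
have cf : continuous f.
  move=> z; apply/differentiable_continuous/derivable1_diffP.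
  exact: (@ex_derive _ _ _ _ _ _ _ (ff' z)).
split.
  apply: continuous_compact_integrable; first exact: segment_compact.
  exact: continuous_subspaceT.
move=> z /andP[]; rewrite le_eqVlt => /predU1P[<- _|z0 _].
  by rewrite set_itv1 Rintegral_set1 addr0.
rewrite /Rintegral (@continuous_FTC2 _ f' f)//.
- by rewrite -EFinB /= addrC subrK.
- exact: continuous_subspaceT.
- split.
  + by move=> x _; exact: (@ex_derive _ _ _ _ _ _ _ (ff' x)).
  + by apply: cvg_at_right_filter; exact: cf.
  + by apply: cvg_at_left_filter; exact: cf.
- by move=> x _; rewrite derive1E; exact: (@derive_val _ _ _ _ _ _ _ (ff' x)).
Qed.

Lemma is_derive_cosh (x : R) : is_derive x 1 cosh (sinh x).
Proof.
have dN := is_derive_comp_linear (is_derive_expR (-1 * x)).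
have H := is_deriveM (is_deriveD (is_derive_expR x) dN) (is_derive_cst (2^-1 :
  R) x 1).
rewrite (_ : cosh = (expR + fun y => expR (-1 * y)) * cst 2^-1).
  apply: (is_derive_eq H); rewrite /GRing.scale /= /sinh mulN1r; lra.
by apply/funext => y; rewrite /cosh !fctE mulN1r.
Qed.

Lemma is_derive_sinh (x : R) : is_derive x 1 sinh (cosh x).
Proof.
have dN := is_derive_comp_linear (is_derive_expR (-1 * x)).
have H := is_deriveM (is_deriveB (is_derive_expR x) dN) (is_derive_cst (2^-1 :
  R) x 1).
rewrite (_ : sinh = (expR - fun y => expR (-1 * y)) * cst 2^-1).
  apply: (is_derive_eq H); rewrite /GRing.scale /= /cosh mulN1r; lra.
by apply/funext => y; rewrite /sinh !fctE mulN1r.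
Qed.

Lemma is_derive_comp_reflect (f : R -> R) a d z (df : R) :
  is_derive (a * (d - z)) 1 f df ->
  is_derive z 1 (fun y => f (a * (d - y))) (- (a * df)).
Proof.
move=> fdf.
have L : is_derive z 1 (fun y => a * (d - y)) (- a).
  have H := is_deriveZ a (is_deriveB (is_derive_cst d z 1) (is_derive_id z (1 :
    R))).
  by apply: (is_derive_eq H); rewrite /GRing.scale /= sub0r mulrN1.
have H := @is_derive1_comp R f (fun y => a * (d - y)) z _ _ fdf L.
by apply: (is_derive_eq H); rewrite mulrN mulrC.
Qed.

Lemma continuous_cosh : continuous cosh.
Proof.
move=> z; apply/differentiable_continuous/derivable1_diffP.
exact: (@ex_derive _ _ _ _ _ _ _ (is_derive_cosh z)).
Qed.

Lemma continuous_sinh : continuous sinh.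
Proof.
move=> z; apply/differentiable_continuous/derivable1_diffP.
exact: (@ex_derive _ _ _ _ _ _ _ (is_derive_sinh z)).
Qed.

Lemma cosh_ge0 (x : R) : 0 <= cosh x.
Proof. by rewrite divr_ge0// addr_ge0 ?expR_ge0. Qed.

Lemma cosh_le_expR_norm (x : R) : cosh x <= expR `|x|.
Proof.
have h1 : expR x <= expR `|x| by rewrite ler_expR ler_norm.
have h2 : expR (- x) <= expR `|x| by rewrite ler_expR -normrN ler_norm.
by rewrite /cosh; lra.
Qed.

Lemma cosh0 : cosh 0 = 1.
Proof. by rewrite /cosh oppr0 expR0; lra. Qed.

Lemma sinh0 : sinh 0 = 0.
Proof. by rewrite /sinh oppr0 expR0 subrr mul0r. Qed.

Lemma cauchy_solution_cosh d l G : 0 <= l ->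
  cauchy_solution d l (fun=> 0) G%:C
    (fun z => (G * cosh (Num.sqrt l * (d - z)))%:C).
Proof.
move=> l0; set a := Num.sqrt l; have a2 : a * a = l by rewrite -expr2 sqr_sqrtr.
have acC (f f' : R -> R) : real_ac_derivative d f f' ->
    ac_derivative d (fun z => (f z)%:C) (fun z => (f' z)%:C).
  move=> ff'; apply/ac_derivativeP; split => //=.
  by apply: real_ac_derivative_C1 => z; exact: cvg_cst.
have crefl (f : R -> R) (c : R) : continuous f ->
    continuous (fun z => c * f (a * (d - z))).
  move=> cf z; apply: cvgM; first exact: cvg_cst.
  apply: (@continuous_comp _ _ _ (fun z => a * (d - z)) f); last exact: cf.
  apply: cvgM; first exact: cvg_cst.
  by apply: cvgB; [exact: cvg_cst|exact: cvg_id].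
exists (fun z => (- (a * G) * sinh (a * (d - z)))%:C).
exists (fun z => (l * G * cosh (a * (d - z)))%:C); split.
- apply: acC; apply: real_ac_derivative_C1; last exact/crefl/continuous_sinh.
  move=> z; have H := is_deriveZ G (is_derive_comp_reflect
    (is_derive_cosh (a * (d - z)))).
  by apply: (is_derive_eq H); rewrite /GRing.scale /=; ring.
- apply: acC; apply: real_ac_derivative_C1; last exact/crefl/continuous_cosh.
  move=> z; have H := is_deriveZ (- (a * G)) (is_derive_comp_reflect
    (is_derive_sinh (a * (d - z)))).
  by apply: (is_derive_eq H); rewrite /GRing.scale /= -a2; ring.
- apply: aeW => z _; rewrite oppr0 -rmorphM -rmorphB /=.
  by rewrite (mulrA l) subrr.
- by rewrite subrr mulr0 cosh0 mulr1.
- by rewrite subrr mulr0 sinh0 mulr0.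
Qed.

Lemma cauchy_solution_value0 d l G (v : R -> R[i]) : 0 < d -> 0 < l ->
  cauchy_solution d l (fun=> 0) G%:C v ->
  v 0 = (G * cosh (Num.sqrt l * d))%:C.
Proof.
move=> d0 l0 [v1 [v2 [/ac_derivativeP[rv iv] /ac_derivativeP[rv1 iv1]]]].
move=> eqn vd v1d.
have re : complex.Re (v 0) = G * cosh (Num.sqrt l * d).
  apply: (cauchy_value0 d0 l0 rv rv1); rewrite ?vd ?v1d//.
  move: eqn; apply: filterS; first exact: (ae_filter_ringOfSetsType mu1).
  move=> z /[swap] zd /(_ zd); rewrite oppr0 => /eqP;
    rewrite subr_eq0 => /eqP ->.
  by case: (v z) => x y /=; ring.
have im : complex.Im (v 0) = 0 * cosh (Num.sqrt l * d).
  apply: (cauchy_value0 d0 l0 iv iv1); rewrite ?vd ?v1d//.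
  move: eqn; apply: filterS; first exact: (ae_filter_ringOfSetsType mu1).
  move=> z /[swap] zd /(_ zd); rewrite oppr0 => /eqP;
    rewrite subr_eq0 => /eqP ->.
  by case: (v z) => x y /=; ring.
by move: re im; case: (v 0) => x y /= -> ->; rewrite mul0r.
Qed.

End Cauchy.

(** * Bumps moving to high frequencies *)

Section Bump.
Context {R : realType}.
Implicit Types (s t c : R) (rho : R * R).
Notation leb := (@lebesgue_measure R).

Definition tent s : R := Num.max 0 (1 - `|s|).

Lemma tent_ge0 s : 0 <= tent s. Proof. by rewrite le_max lexx. Qed.

Lemma tent_le1 s : tent s <= 1.
Proof. by rewrite ge_max ler01 lerBlDr lerDl normr_ge0. Qed.

Lemma tent_supp s : tent s != 0 -> `|s| < 1.
Proof.
apply: contraNT; rewrite -leNgt => s1; apply/eqP/max_idPl.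
by rewrite subr_le0.
Qed.

Lemma continuous_tent : continuous tent.
Proof.
move=> s; apply: (@continuous_max R R (fun=> 0) (fun s => 1 - `|s|) s).
  exact: cvg_cst.
by apply: cvgB; [exact: cvg_cst|exact: norm_continuous].
Qed.

Let measurable_tent : measurable_fun setT tent.
Proof. by apply: continuous_measurable_fun; exact: continuous_tent. Qed.

Lemma integrable_tent : leb.-integrable setT (EFin \o tent).
Proof.
apply: (le_integrable_real _ _ (integrable_indic_itv (-1) 1 true false)) => //.
move=> s; rewrite ger0_norm ?tent_ge0//.
have [->|/tent_supp s1] := eqVneq (tent s) 0; first by rewrite indicE.
rewrite indicE mem_set ?tent_le1//=; rewrite in_itv /=.
by move: s1; rewrite ltr_norml => /andP[/ltW -> /ltW ->].
Qed.

Let ctent2 : continuous (fun s => tent s ^+ 2).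
Proof.
move=> s; apply: (@continuous_comp _ _ _ tent (fun x => x ^+ 2)).
  exact: continuous_tent.
exact: exprn_continuous.
Qed.

Let itent2 : leb.-integrable setT (EFin \o (fun s => tent s ^+ 2)).
Proof.
apply: (integrable_mul_bounded (M := 1) _ _ integrable_tent) => // s.
by rewrite ger0_norm ?tent_ge0// tent_le1.
Qed.

(** The squared [L^2] norm of [tent], hence the [L^2] norm of every [bump]. *)
Definition tent_mass : R := \int[leb]_s (tent s ^+ 2).

Lemma tent_mass_gt0 : 0 < tent_mass.
Proof.
have Ii : leb.-integrable setT (EFin \o (fun s => 4^-1 *
    (\1_[set` Interval (BSide true (- 2^-1 : R)) (BSide false (2^-1))] s))).
  exact: integrable_scale (integrable_indic_itv _ _ _ _).
apply: (@lt_le_trans _ _ (\int[leb]_s (4^-1 *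
    (\1_[set` Interval (BSide true (- 2^-1 : R)) (BSide false (2^-1))] s)))).
  rewrite RintegralZl//; last exact: integrable_indic_itv.
  rewrite mulr_gt0// /Rintegral integral_indic// setIT.
  have : 0 < fine (leb `[- 2^-1, 2^-1]).
    have -> : leb `[- 2^-1, 2^-1] = (2^-1 - - 2^-1)%:E.
      apply: etrans (lebesgue_measure_itv `[- 2^-1, 2^-1]) _.
      by rewrite /= lte_fin ifT ?EFinB//; lra.
    by rewrite /=; lra.
  exact.
apply: le_Rintegral => // s _; rewrite indicE.
have [|_] := boolP (s \in _); last by rewrite mulr0 sqr_ge0.
rewrite inE /= in_itv /= => /andP[s1 s2]; rewrite mulr1.
have : 2^-1 <= tent s.
  rewrite /tent le_max; apply/orP; right.
  have : `|s| <= 2^-1 by rewrite ler_norml s1.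
  lra.
by nra.
Qed.

Definition bump c rho : R := tent (rho.1 - c) * tent rho.2.

Lemma bump_ge0 c rho : 0 <= bump c rho.
Proof. by rewrite mulr_ge0 ?tent_ge0. Qed.

Lemma bump_le1 c rho : bump c rho <= 1.
Proof. by rewrite mulr_ile1 ?tent_ge0 ?tent_le1. Qed.

Lemma bump_supp c rho : bump c rho != 0 -> `|rho.1 - c| < 1 /\ `|rho.2| < 1.
Proof. by rewrite mulf_eq0 negb_or => /andP[/tent_supp ? /tent_supp ?]. Qed.

Lemma continuous_bump c : continuous (bump c).
Proof.
move=> rho; apply: cvgM.
  apply: (@continuous_comp _ _ _ (fun x : R * R => x.1 - c) tent).
    by apply: cvgB; [exact: cvg_fst|exact: cvg_cst].
  exact: continuous_tent.
apply: (@continuous_comp _ _ _ (fun x : R * R => x.2) tent).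
  exact: cvg_snd.
exact: continuous_tent.
Qed.

Lemma measurable_bump c : measurable_fun setT (bump c).
Proof.
apply: measurable_funM; apply: (measurableT_comp measurable_tent) => //.
exact: measurable_funB.
Qed.

Lemma integrable_bump c : (@mu2 R).-integrable setT (EFin \o bump c).
Proof.
apply: (integrable_plane_tensor (f := fun s => tent (s - c))) => //.
  apply: ge0_integrable_translate.
  - exact: continuous_tent.
  - exact: tent_ge0.
  - have /integrableP[_] := integrable_tent.
    by under eq_integral do rewrite /= ger0_norm ?tent_ge0//.
exact: integrable_tent.
Qed.

Lemma Rintegral_bump_sqr c :
  \int[@mu2 R]_rho (bump c rho ^+ 2) = tent_mass ^+ 2.
Proof.
have it : leb.-integrable setT (EFin \o (fun s => tent (s - c) ^+ 2)).
  apply: (ge0_integrable_translate (f := fun s => tent s ^+ 2)) => //.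
    by move=> s; exact: sqr_ge0.
  have /integrableP[_] := itent2.
  by under eq_integral do rewrite /= ger0_norm ?sqr_ge0//.
under eq_Rintegral do rewrite exprMn.
rewrite (Rintegral_plane_tensor it itent2) [RHS]expr2; congr (_ * _).
rewrite /tent_mass /Rintegral; congr fine.
apply: (ge0_integral_translate (f := fun s => tent s ^+ 2)) => //.
by move=> s; exact: sqr_ge0.
Qed.

End Bump.

Section Profile.
Context {R : realType}.
Variables (d k : R).
Hypotheses (d_gt0 : 0 < d) (k_gt0 : 0 < k).
Implicit Types (n : nat) (z : R) (rho : R * R).

(** Far enough out for the bump, of half-width 1, to lie where
    [n.+1 ^+ 2 <= lambda]. *)
Definition center n : R := k + n.+1%:R + 1.

Definition nbump n rho : R := bump (center n) rho.

(** The transformed solution at height [z]: boundary data of size [1 / n.+1],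
    amplified by [cosh (sqrt lambda (d - z))]. *)
Definition profile n z rho : R :=
  n.+1%:R^-1 * nbump n rho * cosh (Num.sqrt (lambda k rho) * (d - z)).

Lemma lambda_nbump n rho : nbump n rho != 0 -> n.+1%:R ^+ 2 <= lambda k rho.
Proof.
move=> /bump_supp[]; rewrite ltr_norml /center => /andP[lo _] _.
have n0 : (0 : R) <= n.+1%:R by [].
rewrite /lambda /dotR2.
have h : k + n.+1%:R <= rho.1 by lra.
have h2 : (k + n.+1%:R) ^+ 2 <= rho.1 ^+ 2.
  by rewrite lerXn2r// ?nnegrE ?addr_ge0 ?(le_trans _ h)// ?addr_ge0// ltW.
have := sqr_ge0 rho.2; have := mulr_ge0 (ltW k_gt0) n0; nra.
Qed.

Lemma nbump_notA1 n rho : ~ A1 k rho -> nbump n rho = 0.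
Proof.
move=> nA; apply/eqP/negPn/negP => /lambda_nbump h; apply: nA.
by apply: lt_le_trans h; rewrite exprn_gt0.
Qed.

Lemma profile_ge0 n z rho : 0 <= profile n z rho.
Proof.
by rewrite /profile mulr_ge0 ?cosh_ge0// mulr_ge0 ?bump_ge0// invr_ge0.
Qed.

Definition profile_bound n z : R :=
  expR (Num.sqrt ((center n + 1) ^+ 2 + 1) * `|d - z|).

Lemma profile_le_bump n z rho :
  profile n z rho <= profile_bound n z * nbump n rho.
Proof.
have [b0|b0] := eqVneq (nbump n rho) 0.
  by rewrite /profile b0 !mulr0 mul0r.
rewrite /profile mulrAC mulrC [leRHS]mulrC ler_wpM2l ?bump_ge0//.
rewrite -[leRHS]mul1r ler_pM ?cosh_ge0//;
  first by rewrite invf_le1 ?ltr0n// ler1n.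
rewrite (le_trans (cosh_le_expR_norm _))// /profile_bound ler_expR normrM.
rewrite ler_wpM2r// ger0_norm ?sqrtr_ge0// ler_wsqrtr//.
have /bump_supp[] := b0; rewrite !ltr_norml => /andP[lo1 hi1] /andP[lo2 hi2].
have n0 : (0 : R) <= n.+1%:R by [].
rewrite /lambda /dotR2; move: lo1 hi1; rewrite /center => lo1 hi1.
have p1 : 0 <= rho.1 by have := k_gt0; lra.
nra.
Qed.

Lemma profile_le n z rho : profile n z rho <= profile_bound n z.
Proof.
rewrite (le_trans (profile_le_bump _ _ _))// ler_piMr ?expR_ge0//.
exact: bump_le1.
Qed.

Lemma measurable_profile n z : measurable_fun setT (profile n z).
Proof.
apply: measurable_funM.
  by apply: measurable_funM => //; exact: measurable_bump.
apply: (measurableT_comp (continuous_measurable_fun (@continuous_cosh R))).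
apply: measurable_funM => //.
apply: (measurableT_comp (continuous_measurable_fun (@sqrt_continuous R))).
by apply: measurable_funB => //; apply: measurable_funD; apply: measurable_funM.
Qed.

Lemma continuous_profile n z : continuous (profile n z).
Proof.
move=> rho; apply: cvgM.
  by apply: cvgM; [exact: cvg_cst|exact: continuous_bump].
apply: (@continuous_comp _ _ _
  (fun rho => Num.sqrt (lambda k rho) * (d - z)) cosh);
    last exact: continuous_cosh.
apply: cvgM; last exact: cvg_cst.
apply: (@continuous_comp _ _ _ (lambda k) Num.sqrt);
  last exact: sqrt_continuous.
apply: cvgB; last exact: cvg_cst.
by apply: cvgD; apply: cvgM; (exact: cvg_fst || exact: cvg_snd).
Qed.

Lemma integrable_profile n z :
  (@mu2 R).-integrable setT (EFin \o profile n z).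
Proof.
apply: (le_integrable_real _ _
  (integrable_scale (profile_bound n z) (integrable_bump (center n)))).
  exact: measurable_profile.
by move=> rho; rewrite ger0_norm ?profile_ge0//; exact: profile_le_bump.
Qed.

Lemma profile_d n rho : profile n d rho = n.+1%:R^-1 * nbump n rho.
Proof. by rewrite /profile subrr mulr0 cosh0 mulr1. Qed.

Lemma profile_notA1 n z rho : ~ A1 k rho -> profile n z rho = 0.
Proof. by move=> /nbump_notA1 b0; rewrite /profile b0 mulr0 mul0r. Qed.

Lemma is_fourier_profile n z :
  is_fourier (inverse_fourier (profile n z)) (fun rho => (profile n z rho)%:C).
Proof.
exact: (fourier_inversion (measurable_profile n z) (profile_ge0 n z)
  (profile_le n z) (integrable_profile n z) (@continuous_profile n z)).
Qed.

(** Where the bump lives, [n.+1 <= sqrt lambda]; the quadratic term of the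
    exponential series already beats the factor [n.+1%:R^-1]. *)
Lemma profile0_ge n rho :
  n.+1%:R * d ^+ 2 / 4 * nbump n rho <= profile n 0 rho.
Proof.
have [b0|b0] := eqVneq (nbump n rho) 0.
  by rewrite /profile b0 !mulr0 mul0r.
rewrite /profile subr0 [leRHS]mulrAC ler_wpM2r ?bump_ge0//.
have m0 : (0 : R) < n.+1%:R by [].
rewrite -(ler_pM2l m0) [leRHS]mulrA mulfV ?gt_eqF// mul1r.
have lm : n.+1%:R <= Num.sqrt (lambda k rho).
  by rewrite -(ger0_norm (ltW m0)) -sqrtr_sqr ler_wsqrtr// lambda_nbump.
have x0 : 0 <= n.+1%:R * d by rewrite mulr_ge0// ltW.
have e1 : 1 + (n.+1%:R * d) ^+ 2 / 2 <= expR (Num.sqrt (lambda k rho) * d).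
  apply: (le_trans (expR_ge1Dxn 1 x0)).
  by rewrite ler_expR ler_wpM2r// ltW.
have := expR_ge0 (- (Num.sqrt (lambda k rho) * d)).
move: e1; rewrite /cosh; set E := expR _; set E' := expR _.
by rewrite exprMn; lra.
Qed.

End Profile.

(** * Instability *)

Section Zero.
Context {R : realType}.

Lemma L2norm0 {d : measure_display} {T : measurableType d}
    (mu : {measure set T -> \bar R}) (D : set T) :
  L2norm mu D (fun=> 0 : R[i]) = 0%E.
Proof.
rewrite /L2norm -[RHS](@Lnorm0 _ _ _ mu 2%:E); last by rewrite eqe pnatr_eq0.
apply: eq_Lnorm => x; rewrite patchE; case: ifP => //= _.
by rewrite expr0n /= addr0 sqrtr0.
Qed.

Lemma inL2_0 {d : measure_display} {T : measurableType d}
    (mu : {measure set T -> \bar R}) (D : set T) : inL2 mu D (fun=> 0 : R[i]).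
Proof.
by split; [split => /=; exact: measurable_cst|rewrite L2norm0 ltry].
Qed.

Lemma is_fourier0 : @is_fourier R (fun=> 0) (fun=> 0).
Proof.
split; [exact: inL2_0|exact: inL2_0|exists (fun _ => fun=> 0); split].
- move=> _; split; last exact: inL2_0.
  split; apply: (eq_integrable measurableT (cst 0%E)) => //;
    exact: integrable0.
- rewrite (_ : (fun xi : R * R => 0 - 0 : R[i]) = fun=> 0).
    by rewrite L2norm0; exact: cvg_cst.
  by apply/funext => xi; rewrite subrr.
- rewrite (_ : (fun rho => _) = (fun=> 0 : R[i])).
    by rewrite L2norm0; exact: cvg_cst.
  apply/funext => rho; rewrite fourierL1E subr0 /=.
  under eq_Rintegral do rewrite !mul0r addr0.
  under [X in _ +i* X]eq_Rintegral do rewrite !mul0r subr0.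
  by rewrite /Rintegral integral0.
Qed.

Lemma is_layer_fourier0 (d : R) : is_layer_fourier d (fun=> 0) (fun=> 0).
Proof.
by split; [exact: inL2_0|exact: inL2_0|exact: (aeW _ (fun z _ => is_fourier0))].
Qed.

End Zero.

Section Instability.
Context {R : realType}.
Variables (d k : R).
Hypotheses (d_gt0 : 0 < d) (k_gt0 : 0 < k).

Lemma nbump_L2 n :
  inL2 mu2 setT (fun rho => (nbump k n rho)%:C) /\
  inL2 mu2 setT (inverse_fourier (nbump k n)) /\
  L2norm mu2 setT (inverse_fourier (nbump k n)) = tent_mass%:E.
Proof.
have mb := measurable_bump (center k n); have b0 := bump_ge0 (center k n).
have b1 := bump_le1 (center k n); have bi := integrable_bump (center k n).
have bc := @continuous_bump R (center k n).
have [vi vE] := plancherel mb b0 b1 bi bc.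
have [_ bL _] := fourier_inversion mb b0 b1 bi bc.
have [vL _ _] := fourier_inversion mb b0 b1 bi bc.
split => //; split => //.
rewrite L2norm_sqrt// vE Rintegral_bump_sqr sqrtr_sqr ger0_norm//.
exact: ltW (tent_mass_gt0).
Qed.

Lemma data_cvg0 :
  L2norm mu2 setT (inverse_fourier (profile d k n d)) @[n --> \oo] --> 0%E.
Proof.
have P n := plancherel (measurable_profile d k n d) (profile_ge0 d k n d)
  (profile_le d k_gt0 n d) (integrable_profile d k_gt0 n d)
  (@continuous_profile R d k n d).
apply: L2norm_cvg0 => [n|]; first exact: (P n).1.
have E n : \int[@mu2 R]_xi abs2 (inverse_fourier (profile d k n d)) xi =
    n.+1%:R^-1 * (n.+1%:R^-1 * tent_mass ^+ 2).
  rewrite (P n).2.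
  under eq_Rintegral do rewrite profile_d exprMn.
  rewrite RintegralZl ?Rintegral_bump_sqr//; first by rewrite expr2 mulrA.
  have := integrable_sqr (measurable_bump (center k n)) (bump_ge0 _)
    (bump_le1 _) (integrable_bump (center k n)).
  exact.
rewrite (funext E) -[X in _ --> X](mul0r (0 * tent_mass ^+ 2)).
apply: cvgM; first exact: cvg_harmonic.
by apply: cvgM; [exact: cvg_harmonic|exact: cvg_cst].
Qed.

(** Test the transformed trace against the bump [nbump k n], whose inverse
    transform has norm [tent_mass], and apply the Cauchy-Schwarz inequality on
    the space side. *)
Lemma trace_lower_bound n (u uh : R * R -> R[i]) : is_fourier u uh ->
  {ae (@mu2 R), forall rho, uh rho = (profile d k n 0 rho)%:C} ->
  ((n.+1%:R * d ^+ 2 / 4 * tent_mass)%:E <= L2norm mu2 setT u)%E.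
Proof.
move=> uuh uhE; have [bL [vL vN]] := nbump_L2 n.
have bi := integrable_bump (center k n).
have uhL : inL2 mu2 setT uh by case: uuh.
have uL : inL2 mu2 setT u by case: uuh.
have P := parseval uuh bi bL vL.
have pbi : (@mu2 R).-integrable setT
    (EFin \o (fun rho => profile d k n 0 rho * nbump k n rho)).
  apply: (plane_mul_bounded (M := 1) _ _ (integrable_profile d k_gt0 n 0)).
    exact: measurable_bump.
  by move=> rho; rewrite ger0_norm ?bump_ge0// bump_le1.
have PE : \int[@mu2 R]_rho pairing uh (fun rho => (nbump k n rho)%:C) rho =
    \int[@mu2 R]_rho (profile d k n 0 rho * nbump k n rho).
  congr fine; apply: ae_eq_integral => //.
  - exact: measurable_int (integrable_pairing uhL bL).
  - exact: measurable_int pbi.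
  - move: uhE; apply: filterS; first exact: (ae_filter_ringOfSetsType mu2).
    by move=> rho E _; rewrite /pairing E /= mul0r addr0.
have b2i := integrable_sqr (measurable_bump (center k n)) (bump_ge0 _)
  (bump_le1 _) bi.
have lower : n.+1%:R * d ^+ 2 / 4 * tent_mass ^+ 2 <=
    \int[@mu2 R]_rho (profile d k n 0 rho * nbump k n rho).
  rewrite -(Rintegral_bump_sqr (center k n)) -RintegralZl//.
  apply: le_Rintegral => //; first exact: integrable_scale.
  move=> rho _; rewrite [bump _ _ ^+ 2]expr2 mulrA ler_wpM2r ?bump_ge0//.
  exact: profile0_ge.
have q0 : 0 < tent_mass :> R := tent_mass_gt0.
have := Rintegral_pairing_le uL vL; rewrite -P PE vN => upper.
have : ((n.+1%:R * d ^+ 2 / 4 * tent_mass)%:E * tent_mass%:E <=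
    L2norm mu2 setT u * tent_mass%:E)%E.
  apply: le_trans upper; rewrite -EFinM lee_fin.
  apply: le_trans (le_trans lower (ler_norm _)).
  by rewrite [tent_mass ^+ 2]expr2 (mulrA _ tent_mass).
by rewrite lee_pmul2r// lte_fin.
Qed.

End Instability.

Theorem lemma6 (R : realType) (d k : R)
    (d_gt0 : 0 < d) (k_gt0 : 0 < k) (kd_lt : k * d < pi / 2) :
  exists (g gh : nat -> R * R -> R[i]) (f fh : nat -> R * R * R -> R[i]),
    [/\ forall n, is_fourier (g n) (gh n) /\ is_layer_fourier d (f n) (fh n),
        forall n rho, ~ A1 k rho ->
          gh n rho = 0 /\ forall z, 0 < z < d -> fh n (rho, z) = 0,
        L2norm mu2 setT (g n) @[n --> \oo] --> 0%E /\
          L2norm mu3 (layer d) (f n) @[n --> \oo] --> 0%E,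
        exists uh u : nat -> R * R * R -> R[i],
          forall n, corresponding_solution d k (gh n) (fh n) (uh n) (u n) &
        forall uh u : nat -> R * R * R -> R[i],
          (forall n, corresponding_solution d k (gh n) (fh n) (uh n) (u n)) ->
          L2norm mu2 setT (fun xi => u n (xi, 0)) @[n --> \oo] --> +oo%E].
Proof.
exists (fun n => inverse_fourier (profile d k n d)).
exists (fun n rho => (profile d k n d rho)%:C).
exists (fun _ => fun=> 0), (fun _ => fun=> 0); split.
- by move=> n; split; [exact: is_fourier_profile|exact: is_layer_fourier0].
- by move=> n rho /(profile_notA1 d k_gt0) ->.
- split; first exact: data_cvg0.
  by rewrite L2norm0; exact: cvg_cst.
- exists (fun n x => (profile d k n x.2 x.1)%:C).
  exists (fun n x => inverse_fourier (profile d k n x.2) x.1) => n; split.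
  + apply: aeW => rho rA; rewrite /= profile_d.
    exact: cauchy_solution_cosh (ltW rA).
  + by apply: aeW => rho /(profile_notA1 d k_gt0) rA z _; rewrite /= rA.
  + by move=> z _; exact: is_fourier_profile.
- move=> uh u sol.
  have bound n : ((n.+1%:R * d ^+ 2 / 4 * tent_mass)%:E <=
      L2norm mu2 setT (fun xi => u n (xi, 0%R)))%E.
    have [solA sol0 solF] := sol n.
    have z0 : (0 : R) <= 0 <= d by rewrite lexx ltW.
    apply: (trace_lower_bound (uh := fun rho => uh n (rho, 0)) d_gt0 k_gt0).
      exact: solF.
    move: solA sol0; apply: filterS2;
      first exact: (ae_filter_ringOfSetsType mu2).
    move=> rho hA h0; have [rA|rA] := pselect (A1 k rho); last first.
      by rewrite h0// profile_notA1.
    rewrite (cauchy_solution_value0 d_gt0 rA (hA rA)) /profile subr0.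
    by rewrite -/(profile d k n d rho) profile_d.
  have c0 : 0 < d ^+ 2 / 4 * tent_mass :> R.
    by rewrite mulr_gt0 ?tent_mass_gt0// divr_gt0// exprn_gt0.
  apply/cvgeyPge => A.
  have : (n%:R : R) @[n --> \oo] --> +oo%R by exact: cvgr_idn.
  move/cvgryPge => /(_ (A / (d ^+ 2 / 4 * tent_mass))).
  apply: filterS => n nA; apply: le_trans (bound n); rewrite lee_fin.
  rewrite -2!mulrA [d ^+ 2 * _]mulrA -ler_pdivrMr//.
  by rewrite (le_trans nA)// ler_nat.
Qed.
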